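(* Consider the warping function $f(\rho)=\ln(2\cosh\rho)$ on the hyperbolic disc $\mathbb{H}$, where $\rho\ge0$ is the hyperbolic distance from the origin. For each constant $H>1$ there exists a rotational (topological) sphere $S^H$ embedded in the warped product $\mathbb{H}\times_f\mathbb{R}$ having constant mean curvature $H$, which is invariant under the group $\mathfrak{G}$ of rotations about the origin of $\mathbb{H}$ and which, up to vertical translation, is a bi-graph with respect to the slice $\mathbb{H}_0=\mathbb{H}\times_f\{0\}$.
   Context: $\mathbb{H}$ is the hyperbolic disc of constant curvature $-1$, with polar coordinates $(\rho,\theta)$ centered at the origin, in which $g_{\mathbb{H}}=d\rho^2+\sinh^2\!\rho\,d\theta^2$. The warped product $\mathbb{H}\times_f\mathbb{R}$ is $\mathbb{H}\times\mathbb{R}$ with the metric $g_{\mathbb{H}}+e^{2f}dt^2$. $\mathfrak{G}$ is the group of rotations of $\mathbb{H}$ about the origin, acting on $\mathbb{H}\times_f\mathbb{R}$ through the first factor; vertical translations are $(p,t)\mapsto(p,t+c)$. Mean curvature is half the trace of the second fundamental form. A bi-graph with respect to $\mathbb{H}_0$ is a surface that is the union of the graph of a function $u\ge0$ over a domain of $\mathbb{H}$ and the graph of $-u$, glued along $\mathbb{H}_0$. *)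

(* Defs.v *)
From HB Require Import structures.
From mathcomp Require Import all_boot all_order all_algebra.
From mathcomp Require Import all_classical all_reals all_analysis.

Set Implicit Arguments.
Unset Strict Implicit.
Unset Printing Implicit Defensive.

Import Order.TTheory GRing.Theory Num.Theory.
Import numFieldNormedType.Exports.

Local Open Scope classical_set_scope.
Local Open Scope ring_scope.

(* The order-k condition asks for Fréchet differentiability at every level, so
   in finite dimension it is C^k: the partial derivatives alone need not even
   make f continuous. *)
Fixpoint Ck_on (R : realType) (V W : normedModType R) (k : nat)
    (U : set V) (f : V -> W) : Prop :=
  match k with
  | 0 => forall x, U x -> {for x, continuous f}
  | k'.+1 => (forall x, U x -> differentiable f x) /\
             (forall v : V, Ck_on k' U (fun x => 'D_v f x))
  end.

(* Meaningful for open U. *)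
Definition smooth_on (R : realType) (V W : normedModType R)
    (U : set V) (f : V -> W) : Prop := forall k, Ck_on k U f.

(* f restricts to a homeomorphism of A onto B for the induced topologies;
   values outside A and B are irrelevant. *)
Definition homeomorphism_on (T1 T2 : topologicalType)
    (A : set T1) (B : set T2) (f : T1 -> T2) : Prop :=
  {within A, continuous f} /\ f @` A = B /\
  exists g : T2 -> T1,
    {within B, continuous g} /\ (forall x, A x -> g (f x) = x).

Definition homeomorphic (T1 T2 : topologicalType)
    (A : set T1) (B : set T2) : Prop :=
  exists f : T1 -> T2, homeomorphism_on A B f.

Section Riemannian.
Variable R : realType.

(* A Riemannian metric on an open subset of R^n is given by its Gram matrix
   g p in the coordinate frame; tangent vectors are row vectors. *)
Definition inner n (g : 'rV[R]_n -> 'M[R]_n) (p v w : 'rV[R]_n) : R :=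
  (v *m g p *m w^T) 0 0.

Definition pd n (W : normedModType R) (i : 'I_n) (F : 'rV[R]_n -> W) :
  'rV[R]_n -> W := fun p => 'D_(delta_mx 0 i) F p.

Definition christoffel n (g : 'rV[R]_n -> 'M[R]_n) (p : 'rV[R]_n)
    (k i j : 'I_n) : R :=
  2^-1 * \sum_(l < n) invmx (g p) k l *
    (pd i (fun q => g q j l : R^o) p + pd j (fun q => g q i l : R^o) p
     - pd l (fun q => g q i j : R^o) p).

(* The covariant derivative, along the i-th coordinate line of the
   parametrized surface X, of the j-th coordinate field of X. *)
Definition covariant_pd2 n (g : 'rV[R]_n -> 'M[R]_n)
    (X : 'rV[R]_2 -> 'rV[R]_n) (u : 'rV[R]_2) (i j : 'I_2) : 'rV[R]_n :=
  pd i (pd j X) u +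
  \row_k \sum_a \sum_b
    christoffel g (X u) k a b * pd i X u 0 a * pd j X u 0 b.

Definition first_form n (g : 'rV[R]_n -> 'M[R]_n)
    (X : 'rV[R]_2 -> 'rV[R]_n) (u : 'rV[R]_2) : 'M[R]_2 :=
  \matrix_(i, j) inner g (X u) (pd i X u) (pd j X u).

Definition second_form n (g : 'rV[R]_n -> 'M[R]_n) (N : 'rV[R]_n -> 'rV[R]_n)
    (X : 'rV[R]_2 -> 'rV[R]_n) (u : 'rV[R]_2) : 'M[R]_2 :=
  \matrix_(i, j) inner g (X u) (covariant_pd2 g X u i j) (N (X u)).

(* Half the trace of the second fundamental form with respect to the first. *)
Definition mean_curvature n (g : 'rV[R]_n -> 'M[R]_n)
    (N : 'rV[R]_n -> 'rV[R]_n) (X : 'rV[R]_2 -> 'rV[R]_n) (u : 'rV[R]_2) : R :=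
  2^-1 * \tr (invmx (first_form g X u) *m second_form g N X u).

Definition local_parametrization n (S : set 'rV[R]_n)
    (U : set 'rV[R]_2) (X : 'rV[R]_2 -> 'rV[R]_n) : Prop :=
  [/\ open U,
      smooth_on U X,
      forall u, U u -> row_free ('J X u),
      homeomorphism_on U (X @` U) X
    & exists W : set 'rV[R]_n, open W /\ X @` U = S `&` W].

Definition embedded_surface n (S : set 'rV[R]_n) : Prop :=
  forall p, S p -> exists U X,
    local_parametrization S U X /\ (X @` U) p.

Definition unit_normal_field n (g : 'rV[R]_n -> 'M[R]_n) (S : set 'rV[R]_n)
    (N : 'rV[R]_n -> 'rV[R]_n) : Prop :=
  [/\ {within S, continuous N},
      forall p, S p -> inner g p (N p) (N p) = 1
    & forall U X, local_parametrization S U X ->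
        forall u, U u -> forall i, inner g (X u) (pd i X u) (N (X u)) = 0].

Definition constant_mean_curvature n (g : 'rV[R]_n -> 'M[R]_n)
    (S : set 'rV[R]_n) (H : R) : Prop :=
  exists N, unit_normal_field g S N /\
    forall U X, local_parametrization S U X ->
      forall u, U u -> mean_curvature g N X u = H.

Definition sqnorm n (x : 'rV[R]_n) : R := \sum_i x 0 i ^+ 2.

Definition unit_sphere2 : set 'rV[R]_3 := [set x | sqnorm x = 1].

End Riemannian.

Section WarpedProduct.
Variable R : realType.

(* The hyperbolic plane is the Poincaré disc; the point with polar coordinates
   (rho, theta) is tanh (rho / 2) (cos theta, sin theta), and
   4 |dx|^2 / (1 - |x|^2)^2 = drho^2 + sinh^2 rho dtheta^2. *)
Definition disc : set 'rV[R]_2 := [set x | sqnorm x < 1].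

Definition rho (x : 'rV[R]_2) : R :=
  ln ((1 + Num.sqrt (sqnorm x)) / (1 - Num.sqrt (sqnorm x))).

(* The point (x, t) of disc * R is the row vector row_mx x (const_mx t). *)
Definition base (p : 'rV[R]_(2 + 1)) : 'rV[R]_2 := lsubmx p.

Definition height (p : 'rV[R]_(2 + 1)) : R := rsubmx p 0 0.

Definition point (x : 'rV[R]_2) (t : R) : 'rV[R]_(2 + 1) :=
  row_mx x (const_mx t).

Definition ambient : set 'rV[R]_(2 + 1) := [set p | disc (base p)].

(* The warping function is f \o rho, for f a function of the distance. *)
Definition warped_metric (f : R -> R) (p : 'rV[R]_(2 + 1)) : 'M[R]_(2 + 1) :=
  diag_mx (row_mx (const_mx (4 / (1 - sqnorm (base p)) ^+ 2))
                  (const_mx (expR (2 * f (rho (base p)))))).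

Definition rotate (a : R) (x : 'rV[R]_2) : 'rV[R]_2 :=
  \row_j (if j == 0 then cos a * x 0 0 - sin a * x 0 1
          else sin a * x 0 0 + cos a * x 0 1).

Definition rotation_invariant (S : set 'rV[R]_(2 + 1)) : Prop :=
  forall a, (fun p => point (rotate a (base p)) (height p)) @` S = S.

Definition vertical_translate (c : R) (S : set 'rV[R]_(2 + 1)) :
  set 'rV[R]_(2 + 1) := (fun p => point (base p) (height p + c)) @` S.

Definition domain (O : set 'rV[R]_2) : Prop :=
  [/\ O !=set0, open O, connected O & O `<=` disc].

(* The graphs of h and - h are taken over the closure of O in the disc; they
   meet, inside the slice of height 0, exactly along the boundary of O. *)
Definition bi_graph (S : set 'rV[R]_(2 + 1)) : Prop :=
  exists (O : set 'rV[R]_2) (h : 'rV[R]_2 -> R^o),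
    let D := closure O `&` disc in
    [/\ domain O,
        {within D, continuous h} /\ smooth_on O h,
        forall x, O x -> 0 < h x,
        forall x, D x -> ~ O x -> h x = 0
      & S = [set point x (h x) | x in D] `|` [set point x (- h x) | x in D]].

Definition cosh (x : R) : R := (expR x + expR (- x)) / 2.

End WarpedProduct.

(* Main.v *)
Require Import Defs.
From HB Require Import structures.
From mathcomp Require Import all_boot all_order all_algebra.
From mathcomp Require Import all_classical all_reals all_analysis.
From mathcomp Require Import ring lra.

(* The warped metric drho^2 + sinh^2 rho dtheta^2 + 4 cosh^2 rho dt^2 is the
   metric of hyperbolic 3-space in cylindrical coordinates around a geodesic
   with arc length s = 2 t, so the constant mean curvature spheres are the
   geodesic spheres cosh rho cosh (2 t) = C. The function Phi on the left is the
   hyperbolic cosine of the distance to the origin and satisfies Hess Phi =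
   Phi g; hence its level set {Phi = C} is umbilic with principal curvatures
   C / sqrt (C^2 - 1), which is H for C = H / sqrt (H^2 - 1). In the upper
   half-space model the level set is a Euclidean sphere, which gives an explicit
   homeomorphism with the unit sphere; smooth charts are graphs over the
   coordinate planes. *)

Import Order.TTheory GRing.Theory Num.Theory.
Import numFieldNormedType.Exports.

Local Open Scope classical_set_scope.
Local Open Scope ring_scope.

Set Implicit Arguments.
Unset Strict Implicit.

(** * Elementary functions are smooth *)

Section Smooth.
Context {R : realType}.

(** [Phi] is the restriction to the hyperboloid of a linear function on Minkowski space, which
    explains why its Hessian is [Phi] times the metric. With d the radius of the sphere, C = cosh d
    and H = coth d. The mean curvature has to be H in every local parametrization X, so it is not
    computed in particular charts. Differentiating Phi (X u) = C twice expresses the normal part of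
    the second derivatives of X through the first ones, and the Christoffel terms complete the
    Hessian. Smoothness asks for Fréchet differentiability of all iterated directional derivatives.
    A syntactic class of functions closed under derivation provides it, but square roots belong to
    it only where the radicand is positive. Hence the metric, defined through the distance rho that
    is singular at the origin, is first rewritten as a rational function of the coordinates; and
    since arcosh is not differentiable at 1, the height of the bi-graph is smooth only inside the
    equator, whose points need charts over vertical planes. *)

Lemma is_derive_chain (V : normedModType R) (f : V -> R^o) (phi : R^o -> R^o)
    (x v : V) (a : R) :
  differentiable f x -> is_derive (f x) 1 phi a ->
  differentiable (phi \o f) x /\ is_derive x v (phi \o f) (a * 'D_v f x).
Proof.
move=> df dphi.
have dphi' : differentiable phi (f x).
  by apply/derivable1_diffP; exact: ex_derive.
have dc : differentiable (phi \o f) x by exact: differentiable_comp.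
split => //; apply: DeriveDef; first exact: diff_derivable.
rewrite deriveE // diff_comp //= diff1E // deriveE // derive1E.
rewrite (derive_val (f:=phi)).
by rewrite mulrC.
Qed.

(** Serves the constructor [elementary_eq]: functions that agree on an open U agree near each of its
    points. *)
Lemma near_eq_differentiable (V W : normedModType R) (f g : V -> W) (x : V) :
  (\near x, f x = g x) -> differentiable f x -> differentiable g x.
Proof.
move=> fg df.
have fgx : f x = g x by exact: nbhs_singleton fg.
have dfc : continuous ('d f x) by exact: diff_continuous.
have E : g \o shift x = cst (g x) + 'd f x +o_ 0 id.
  apply/eqaddoP => e e0; rewrite -fgx.
  have /eqaddoP/(_ e e0) He := diff_locally df.
  have Hs : \forall y \near 0, f (y + x) = g (y + x).
    move: fg; rewrite (near_shift 0) /=; apply: filterS => y.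
    by rewrite subr0.
  near=> y.
  have -> : (g \o shift x - (cst (f x) + 'd f x)) y
    = (f \o shift x - (cst (f x) + 'd f x)) y.
    rewrite !fctE /=; congr (_ - _); symmetry; near: y; exact: Hs.
  by near: y; exact: He.
apply/diff_locallyP; rewrite (diff_unique dfc E); split=> //.
Unshelve. all: by end_near. Qed.

(** The constructors are chosen so that each directional derivative is again elementary; smoothness
    of all orders then follows by one induction on the order. Side conditions and equality are only
    required on U, so that inverses and logarithms may be singular elsewhere. *)
Inductive elementary (V : normedModType R) (U : set V) : (V -> R^o) -> Prop :=
| elementary_lin (f : {linear V -> R^o}) : continuous f -> elementary U f
| elementary_cst (c : R) : elementary U (fun=> c)
| elementaryD f g :
    elementary U f -> elementary U g -> elementary U (fun x => f x + g x)
| elementaryM f g :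
    elementary U f -> elementary U g -> elementary U (fun x => f x * g x)
| elementaryV f : elementary U f -> (forall x, U x -> f x != 0) ->
    elementary U (fun x => (f x)^-1)
| elementary_expR f : elementary U f -> elementary U (fun x => expR (f x))
| elementary_ln f : elementary U f -> (forall x, U x -> 0 < f x) ->
    elementary U (fun x => ln (f x))
| elementary_eq f g :
    elementary U f -> (forall x, U x -> f x = g x) -> elementary U g.

Lemma elementary_derive (V : normedModType R) (U : set V) (f : V -> R^o) :
  open U -> elementary U f ->
  (forall x, U x -> differentiable f x) /\
  (forall v, elementary U (fun x => 'D_v f x)).
Proof.
move=> oU; elim=> {f} [f fc|c|f g ef [df Df] eg [dg Dg]
  |f g ef [df Df] eg [dg Dg]|f ef [df Df] f0|f ef [df Df]|f ef [df Df] f0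
  |f g ef [df Df] fg].
- have df x : differentiable f x by exact: linear_differentiable.
  split=> // v; apply: elementary_eq (elementary_cst _ (f v)) _ => x _.
  by rewrite deriveE // diff_lin.
- split=> [//|v]; apply: elementary_eq (elementary_cst _ 0) _ => x _.
  by rewrite derive_cst.
- split=> [x Ux|v]; first by apply: differentiableD; auto.
  apply: elementary_eq (elementaryD (Df v) (Dg v)) _ => x Ux.
  by rewrite deriveD //; apply: diff_derivable; auto.
- split=> [x Ux|v]; first by apply: differentiableM; auto.
  apply: elementary_eq (elementaryD (elementaryM ef (Dg v))
    (elementaryM eg (Df v))) _ => x Ux.
  by rewrite deriveM //; apply: diff_derivable; auto.
- split=> [x Ux|v]; first by apply: differentiableV; auto.
  have ei := elementaryV ef f0.
  apply: elementary_eq (elementaryM (elementaryM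
    (elementary_cst _ (-1)) (elementaryM ei ei)) (Df v)) _ => x Ux.
  rewrite deriveV ?f0 //; last by apply: diff_derivable; auto.
  by rewrite /GRing.scale /= -exprVn expr2 mulN1r.
- have H x v : U x -> _ := fun Ux => is_derive_chain v (df x Ux)
    (is_derive_expR (f x)).
  split=> [x Ux|v]; first by have [] := H x 0 Ux.
  apply: elementary_eq (elementaryM (elementary_expR ef) (Df v)) _
    => x Ux.
  by have [_ [_ D]] := H x v Ux; exact: esym D.
- have H x v : U x -> _ := fun Ux => is_derive_chain v (df x Ux)
    (is_derive1_ln (f0 x Ux)).
  split=> [x Ux|v]; first by have [] := H x 0 Ux.
  have fn0 x : U x -> f x != 0 by move=> /f0/lt0r_neq0.
  apply: elementary_eq (elementaryM (elementaryV ef fn0) (Df v)) _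
    => x Ux.
  by have [_ [_ D]] := H x v Ux; exact: esym D.
- have fgx x : U x -> \near x, f x = g x.
    by move=> Ux; near=> y; apply: fg; near: y; exact: open_nbhs_nbhs.
  split=> [x Ux|v]; first exact: near_eq_differentiable (fgx x Ux) (df x Ux).
  apply: elementary_eq (Df v) _ => x Ux; exact: near_eq_derive (fgx x Ux).
Unshelve. all: by end_near. Qed.

Lemma elementary_smooth (V : normedModType R) (U : set V) (f : V -> R^o) :
  open U -> elementary U f -> smooth_on U f.
Proof.
move=> oU + k; elim: k f => [|k IH] f ef;
  have [df Df] := elementary_derive oU ef.
  by move=> x Ux; apply: differentiable_continuous; exact: df.
by split=> // v; exact: IH.
Qed.

End Smooth.

(** * Elementary functions of coordinates, and vector-valued maps *)

Section SmoothMatrix.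
Context {R : realType}.

Lemma elementary_coord m n (U : set 'M[R]_(m, n)) i j :
  elementary U (fun x => x i j : R^o).
Proof.
pose f := fun x : 'M[R]_(m, n) => x i j : R^o.
have lin : linear f by move=> a x y; rewrite /f !mxE.
pose fL := GRing.isLinear.Build _ _ _ _ f lin.
pose L : {linear 'M[R]_(m, n) -> R^o} := HB.pack f fL.
rewrite -[fun x => _]/(L : _ -> _).
by apply: elementary_lin => x; exact: coord_continuous.
Qed.

Lemma elementaryN (V : normedModType R) (U : set V) (f : V -> R^o) :
  elementary U f -> elementary U (fun x => - f x).
Proof.
move=> ef.
apply: elementary_eq (elementaryM (elementary_cst _ (-1)) ef) _ => x _.
by rewrite mulN1r.
Qed.

Lemma elementaryB (V : normedModType R) (U : set V) (f g : V -> R^o) :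
  elementary U f -> elementary U g -> elementary U (fun x => f x - g x).
Proof. by move=> ef eg; exact: elementaryD ef (elementaryN eg). Qed.

Lemma elementary_sqr (V : normedModType R) (U : set V) (f : V -> R^o) :
  elementary U f -> elementary U (fun x => f x ^+ 2).
Proof. by move=> ef; exact: elementaryM. Qed.

(** For y > 0, sqrt y = exp (ln y / 2), so the square root needs no constructor of its own. *)
Lemma elementary_sqrt (V : normedModType R) (U : set V) (f : V -> R^o) :
  elementary U f -> (forall x, U x -> 0 < f x) ->
  elementary U (fun x => Num.sqrt (f x)).
Proof.
move=> ef f0; apply: elementary_eq (elementary_expR
  (elementaryM (elementary_cst _ 2^-1) (elementary_ln ef f0))) _ => x /f0 fx0.
apply/eqP; rewrite -(@eqrXn2 _ 2) ?expR_ge0 ?sqrtr_ge0 //.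
rewrite sqr_sqrtr ?ltW // -expRM_natl mulrA divff ?pnatr_eq0 // mul1r lnK //.
Qed.

Lemma elementary_sum (V : normedModType R) (U : set V) n
    (f : 'I_n -> V -> R^o) :
  (forall i, elementary U (f i)) -> elementary U (fun x => \sum_i f i x).
Proof.
elim: n f => [|n IH] f ef.
  by apply: elementary_eq (elementary_cst _ 0) _ => x _; rewrite big_ord0.
apply: elementary_eq
  (elementaryD (ef ord0) (IH (fun i => f (lift ord0 i)) _)) _.
  by move=> i; exact: ef.
by move=> x _; rewrite big_ord_recl.
Qed.

Lemma elementary_continuous (V : normedModType R) (U : set V) (f : V -> R^o) x :
  open U -> elementary U f -> U x -> {for x, continuous f}.
Proof.
move=> oU ef Ux; apply: differentiable_continuous.
by have [df _] := elementary_derive oU ef; exact: df.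
Qed.

Lemma open_elementary_gt0 (V : normedModType R) (f : V -> R^o) :
  elementary setT f -> open [set x | 0 < f x].
Proof.
move=> ef; apply: (@open_comp _ _ f [set y : R | 0 < y]); last exact: open_gt.
by move=> x _; exact: elementary_continuous openT ef I.
Qed.

Lemma elementary_differentiable_rV (V : normedModType R) (U : set V) n
    (F : V -> 'rV[R]_n) x :
  open U -> (forall j, elementary U (fun x => F x 0 j)) -> U x ->
  differentiable F x.
Proof.
move=> oU eF Ux.
have -> : F = \sum_(j < n) (fun x => F x 0 j *: (delta_mx 0 j : 'rV[R]_n)).
  by apply/funext => y; rewrite fct_sumE -row_sum_delta.
apply: differentiable_sum => j; apply: differentiableZl.
by have [df _] := elementary_derive oU (eF j); exact: df.
Qed.

Lemma elementary_smooth_rV (V : normedModType R) (U : set V) n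
    (F : V -> 'rV[R]_n) :
  open U -> (forall j, elementary U (fun x => F x 0 j)) -> smooth_on U F.
Proof.
move=> oU + k; elim: k F => [|k IH] F eF.
  move=> x Ux; apply: differentiable_continuous.
  exact: elementary_differentiable_rV oU eF Ux.
have dF x : U x -> differentiable F x by exact: elementary_differentiable_rV.
split=> // v; apply: IH => j.
have [_ DF] := elementary_derive oU (eF j).
apply: elementary_eq (DF v) _ => x Ux.
by rewrite derive_mx ?mxE //; exact: diff_derivable (dF x Ux).
Qed.

Lemma elementary_continuous_rV (V : normedModType R) (U : set V) n
    (F : V -> 'rV[R]_n) x :
  open U -> (forall j, elementary U (fun x => F x 0 j)) -> U x ->
  {for x, continuous F}.
Proof.
move=> oU eF Ux; apply: differentiable_continuous.
exact: elementary_differentiable_rV oU eF Ux.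
Qed.

Lemma for_within_continuous (T T' : topologicalType) (A : set T) (f : T -> T') :
  (forall x, A x -> {for x, continuous f}) -> {within A, continuous f}.
Proof.
by move=> cf; apply: continuous_in_subspaceT => x; rewrite inE; exact: cf.
Qed.

End SmoothMatrix.

(** * Charts that are graphs over a coordinate plane *)

Section GraphChart.
Context {R : realType}.

Lemma ord2P (j : 'I_2) : j = 0 \/ j = 1.
Proof.
by case: j => [[|[|//]] H]; [left|right]; apply: val_inj.
Qed.

Variables (n : nat) (a b c : 'I_n).
Hypotheses (ab : a != b) (ac : a != c) (bc : b != c).
Hypothesis (abc : forall k, [|| k == a, k == b | k == c]).

(** The sign s, with s * s = 1, selects the half of the surface on which the coordinate c has that
    sign; this half is relatively open, as a chart requires. *)
Definition graph_map (s : R) (phi : 'rV[R]_2 -> R^o) (u : 'rV[R]_2) :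
    'rV[R]_n :=
  \row_k (if k == a then u 0 0 else if k == b then u 0 1 else s * phi u).

Definition graph_proj (p : 'rV[R]_n) : 'rV[R]_2 :=
  \row_j p 0 (if j == 0 then a else b).

Lemma graph_mapK s phi : cancel (graph_map s phi) graph_proj.
Proof.
move=> u; apply/rowP => j; rewrite !mxE.
by have [->|->] := ord2P j; rewrite /= ?eqxx // eq_sym (negbTE ab).
Qed.

Lemma graph_chart (S : set 'rV[R]_n) (U : set 'rV[R]_2) (s : R)
    (phi : 'rV[R]_2 -> R^o) :
  s * s = 1 -> open U -> elementary U phi ->
  (forall u, U u -> 0 < phi u /\ S (graph_map s phi u)) ->
  (forall p, S p -> 0 < s * p 0 c ->
     U (graph_proj p) /\ p 0 c = s * phi (graph_proj p)) ->
  local_parametrization S U (graph_map s phi) /\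
  graph_map s phi @` U = S `&` [set p | 0 < s * p 0 c].
Proof.
move=> ss oU ephi US SU.
have eX j : elementary U (fun u => graph_map s phi u 0 j : R^o).
  case: (boolP (j == a)) => ja.
    by apply: elementary_eq (elementary_coord U 0 0) _ => u _; rewrite mxE ja.
  case: (boolP (j == b)) => jb.
    apply: elementary_eq (elementary_coord U 0 1) _ => u _.
    by rewrite mxE (negbTE ja) jb.
  apply: elementary_eq (elementaryM (elementary_cst _ s) ephi) _ => u _.
  by rewrite mxE (negbTE ja) (negbTE jb).
have dX u : U u -> differentiable (graph_map s phi) u.
  by move=> Uu; exact: elementary_differentiable_rV oU eX Uu.
have im : graph_map s phi @` U = S `&` [set p | 0 < s * p 0 c].
  rewrite eqEsubset; split=> [_ [u Uu <-]|p [Sp sp]].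
    have [phi0 SX] := US u Uu; split=> //=.
    by rewrite mxE eq_sym (negbTE ac) eq_sym (negbTE bc) mulrA ss mul1r.
  have [Up pc] := SU p Sp sp; exists (graph_proj p) => //.
  apply/rowP => k; rewrite !mxE; have := abc k.
  case: eqP => [->//|_]; case: eqP => [->//|_] /= /eqP ->.
  by rewrite pc.
split=> //; split=> //.
- exact: elementary_smooth_rV.
- move=> u Uu; apply/row_freeP.
  (* The matrix of [graph_proj]: by the chain rule for [graph_proj] after [graph_map], which is the
     identity, it is a right inverse of the Jacobian. *)
  exists (\matrix_(k, j) (k == if j == 0 then a else b)%:R).
  set B := \matrix_(k, j) _.
  have BE (p : 'rV[R]_n) : p *m B = graph_proj p.
    apply/rowP => j; rewrite !mxE.
    rewrite (bigD1 (if j == 0 then a else b)) //= mxE eqxx mulr1 big1 ?addr0 //.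
    by move=> k /negbTE kj; rewrite mxE kj mulr0.
  have cB : continuous (mulmxr B : 'rV[R]_n -> 'rV[R]_2).
    move=> p; apply: (@elementary_continuous_rV _ _ setT) => // [|j].
      exact: openT.
    apply: elementary_eq (elementary_coord setT 0 (if j == 0 then a else b)) _.
    by move=> q _; rewrite /= BE mxE.
  have dB p : differentiable (mulmxr B : 'rV[R]_n -> 'rV[R]_2) p.
    exact: linear_differentiable.
  apply/row_matrixP => i; rewrite rowE mulmxA row1.
  rewrite -deriveEjacobian; last exact: dX.
  rewrite deriveE; last exact: dX.
  have /(congr1 (fun f => f (delta_mx 0 i))) :=
    diff_comp (dX u Uu) (dB (graph_map s phi u)).
  rewrite diff_lin //= => <-.
  have -> : mulmxr B \o graph_map s phi = id.
    by apply/funext => w; rewrite /= BE graph_mapK.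
  by rewrite diff_val.
- split; first by apply: for_within_continuous => u Uu;
    exact: differentiable_continuous (dX u Uu).
  split=> //; exists graph_proj; split=> [|u _]; last exact: graph_mapK.
  apply: for_within_continuous => p _.
  apply: (@elementary_continuous_rV _ _ setT) => // [|j]; first exact: openT.
  apply: elementary_eq (elementary_coord setT 0 (if j == 0 then a else b)) _.
  by move=> q _; rewrite mxE.
- exists [set p | 0 < s * p 0 c]; split=> //.
  apply: open_elementary_gt0; apply: elementaryM (elementary_cst _ s) _.
  exact: elementary_coord.
Qed.

End GraphChart.

(** * The warped metric in coordinates *)

Section Coordinates.
Context {R : realType}.
Implicit Types (p w v : 'rV[R]_(2 + 1)).

Definition ix : 'I_(2 + 1) := lshift 1 0.
Definition iy : 'I_(2 + 1) := lshift 1 1.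
Definition it : 'I_(2 + 1) := rshift 2 0.

Lemma ord3P (k : 'I_(2 + 1)) : [\/ k = ix, k = iy | k = it].
Proof.
case: k => [[|[|[|//]]] H]; [apply: Or31|apply: Or32|apply: Or33];
  exact: val_inj.
Qed.

Lemma big_ord3 (F : 'I_(2 + 1) -> R) : \sum_k F k = F ix + F iy + F it.
Proof.
rewrite big_split_ord /= big_ord1 2!big_ord_recl big_ord0 /= addr0.
by congr (F _ + F _ + F _); apply: val_inj.
Qed.

Lemma sqnorm2 (x : 'rV[R]_2) : sqnorm x = x 0 0 ^+ 2 + x 0 1 ^+ 2.
Proof.
rewrite /sqnorm !big_ord_recl big_ord0 addr0.
by congr (x 0 _ ^+ 2 + x 0 _ ^+ 2); apply: val_inj.
Qed.

Lemma sqnorm_base p : sqnorm (base p) = p 0 ix ^+ 2 + p 0 iy ^+ 2.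
Proof. by rewrite sqnorm2 !mxE. Qed.

Lemma heightE p : height p = p 0 it.
Proof. by rewrite /height mxE. Qed.

Definition sinh (x : R) : R := (expR x - expR (- x)) / 2.

Lemma cosh2_sinh2 (x : R) : cosh x ^+ 2 = 1 + sinh x ^+ 2.
Proof.
have := expRxMexpNx_1 x; rewrite /cosh /sinh; set a := expR x; set b := expR _.
by move=> ab; field: ab.
Qed.

(** On the disc [qn] is tanh^2 (rho / 2), so (1 + qn) * mn is cosh rho; [ch] and [sh] take the arc
    length 2 t of the axis as argument. *)
Definition qn p : R^o := p 0 ix ^+ 2 + p 0 iy ^+ 2.
Definition mn p : R^o := (1 - qn p)^-1.
Definition ch p : R^o := cosh (2 * p 0 it).
Definition sh p : R^o := sinh (2 * p 0 it).

Lemma ambientE p : ambient p <-> qn p < 1.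
Proof. by rewrite /ambient /disc /= sqnorm_base. Qed.

Lemma elementary_qn U : elementary U qn.
Proof.
by apply: elementaryD; apply: elementary_sqr; exact: elementary_coord.
Qed.

Lemma open_ambient : open (@ambient R).
Proof.
have -> : @ambient R = [set p | 0 < 1 - qn p].
  by apply/funext => p; apply/propext; rewrite ambientE /= subr_gt0.
apply: open_elementary_gt0.
exact: elementaryB (elementary_cst _ _) (elementary_qn _).
Qed.

Definition gcoef (k : 'I_(2 + 1)) p : R^o :=
  if k == it then 4 * (1 + qn p) ^+ 2 * mn p ^+ 2 else 4 * mn p ^+ 2.

Lemma qn_ge0 p : 0 <= qn p.
Proof. by rewrite addr_ge0 ?sqr_ge0. Qed.

Definition warp (r : R) : R := ln (2 * cosh r).

(** With s = |x|, e^rho = (1 + s) / (1 - s), hence 2 cosh rho = 2 (1 + s^2) / (1 - s^2). Only s^2 is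
    left: the logarithm, and the square root that is singular at the origin, disappear. *)
Lemma warped_metricE p : ambient p ->
  warped_metric warp p = diag_mx (\row_k gcoef k p).
Proof.
move=> /ambientE q1; rewrite /warped_metric; congr diag_mx.
have Q0 := qn_ge0 p; have m0 : 1 - qn p != 0 by rewrite subr_eq0 gt_eqF.
apply/rowP => k; rewrite mxE.
have -> : sqnorm (base p) = qn p by rewrite sqnorm_base.
have k01 (j : 'I_2) : (@lshift 2 1 j == it) = false by rewrite eq_lrshift.
case: splitP => [j kj|j kj].
  have -> : k = lshift 1 j by apply: val_inj.
  by rewrite !mxE /gcoef k01 exprVn.
have -> : k = it by apply: val_inj; rewrite /= kj ord1.
rewrite !mxE /gcoef eqxx /warp /rho.
have -> : sqnorm (base p) = qn p by rewrite sqnorm_base.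
set s := Num.sqrt (qn p).
have s0 : 0 <= s by rewrite sqrtr_ge0.
have ss : qn p = s ^+ 2 by rewrite sqr_sqrtr.
have s1 : s < 1 by rewrite -(@ltr_pXn2r _ 2) ?nnegrE // -ss expr1n.
have z0 : 0 < (1 + s) / (1 - s) by rewrite divr_gt0 ?subr_gt0 // ltr_pwDl.
have y0 : 0 < 2 * cosh (ln ((1 + s) / (1 - s))).
  by rewrite /cosh; have := expR_gt0 (ln ((1 + s) / (1 - s)));
    have := expR_gt0 (- ln ((1 + s) / (1 - s))); lra.
rewrite expRM_natl lnK ?posrE // /cosh expRN lnK ?posrE // /mn ss.
have ? : 1 - s != 0 by rewrite subr_eq0 gt_eqF.
have ? : 1 + s != 0 by rewrite lt0r_neq0 // ltr_pwDl.
have ? : 1 - s ^+ 2 != 0 by rewrite -ss.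
by field; apply/and3P; split=> //; apply/and3P.
Qed.

End Coordinates.

(** * Derivation rules for functions given pointwise *)

Section DeriveLambda.
Context {R : realType} {V : normedModType R}.
Implicit Types (f g : V -> R^o) (x v : V).

Lemma is_derive_addf f g x v df dg : is_derive x v f df -> is_derive x v g dg ->
  is_derive x v (fun y => f y + g y : R^o) (df + dg).
Proof. by move=> Hf Hg; exact: is_deriveD. Qed.

Lemma is_derive_constf (c : R) x v : is_derive x v (fun=> c : R^o) (0 : R^o).
Proof. exact: is_derive_cst. Qed.

Lemma is_derive_oppf f x v df : is_derive x v f df ->
  is_derive x v (fun y => - f y : R^o) (- df).
Proof. by move=> Hf; exact: is_deriveN. Qed.

Lemma is_derive_mulf f g x v df dg : is_derive x v f df -> is_derive x v g dg ->
  is_derive x v (fun y => f y * g y : R^o) (f x * dg + g x * df).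
Proof. by move=> Hf Hg; exact: is_deriveM. Qed.

Lemma is_derive_invf f x v df : f x != 0 -> is_derive x v f df ->
  is_derive x v (fun y => (f y)^-1 : R^o) (- (f x)^-1 ^+ 2 * df).
Proof.
move=> f0 [Df <-]; apply: DeriveDef; first exact: derivableV.
by rewrite deriveV // -exprVn.
Qed.

Lemma is_derive_expRf f x v df : differentiable f x -> is_derive x v f df ->
  is_derive x v (fun y => expR (f y) : R^o) (expR (f x) * df).
Proof.
by move=> Hf [_ <-]; have [_] := is_derive_chain v Hf (is_derive_expR (f x)).
Qed.

End DeriveLambda.

(* [is_derive] is a class; [notypeclasses] keeps instance resolution from
   choosing its own form of the derivative of a subterm. *)
Ltac derive_step leaf := first
  [ leaf
  | notypeclasses refine (is_derive_constf _ _ _)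
  | notypeclasses refine (is_derive_addf _ _)
  | notypeclasses refine (is_derive_oppf _)
  | notypeclasses refine (is_derive_mulf _ _) ].
Ltac derive_with leaf :=
  notypeclasses refine (is_derive_eq _ _); [repeat derive_step leaf|cbv beta].

(** * Derivatives of the metric coefficients and of Phi *)

Section MetricDerivative.
Context {R : realType}.
Implicit Types (p w v : 'rV[R]_(2 + 1)).

Lemma is_derive_coord p w k : is_derive p w (fun p => p 0 k : R^o) (w 0 k).
Proof.
have d : differentiable (fun p : 'rV[R]_(2 + 1) => p 0 k : R^o) p.
  exact: differentiable_coord.
apply: DeriveDef; first exact: diff_derivable.
have := @derive_mx R _ 1 (2 + 1) (@id 'rV[R]_(2+1)) p w (@derivable_id _ _ p w).
by rewrite derive_id => /rowP/(_ k); rewrite mxE => H; exact: esym H.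
Qed.

Ltac coord_leaf := notypeclasses refine (is_derive_coord _ _ _).

Definition dqn p w : R := 2 * (p 0 ix * w 0 ix + p 0 iy * w 0 iy).

Lemma is_derive_qn p w : is_derive p w qn (dqn p w).
Proof. by rewrite /qn; derive_with coord_leaf; rewrite /dqn; ring. Qed.

Ltac qn_leaf := first [coord_leaf | notypeclasses refine (is_derive_qn _ _)].

Lemma is_derive_mn p w : qn p < 1 -> is_derive p w mn (mn p ^+ 2 * dqn p w).
Proof.
move=> q1; have q0 : 1 - qn p != 0 by rewrite subr_eq0 gt_eqF.
have D : is_derive p w (fun p => 1 - qn p : R^o) (- dqn p w).
  by derive_with qn_leaf; rewrite add0r.
notypeclasses refine
  (is_derive_eq (is_derive_invf (f := fun p => 1 - qn p) q0 D) _).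
by rewrite /mn; ring.
Qed.

Lemma is_derive_exp_height p w (c : R) :
  is_derive p w (fun p => expR (c * p 0 it) : R^o)
    (expR (c * p 0 it) * (c * w 0 it)).
Proof.
notypeclasses refine (is_derive_expRf _ _).
  apply: (@differentiableM _ _ (cst c)) => //; exact: differentiable_coord.
by derive_with coord_leaf; rewrite mulr0 addr0.
Qed.

Ltac exp_leaf := notypeclasses refine (is_derive_exp_height _ _ _).

Lemma chE p : ch p = (expR (2 * p 0 it) + expR (- 2 * p 0 it)) / 2.
Proof. by rewrite mulNr. Qed.

Lemma shE p : sh p = (expR (2 * p 0 it) - expR (- 2 * p 0 it)) / 2.
Proof. by rewrite mulNr. Qed.

Lemma is_derive_ch p w : is_derive p w ch (2 * sh p * w 0 it).
Proof. by rewrite (funext chE) shE; derive_with exp_leaf; field. Qed.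

Lemma is_derive_sh p w : is_derive p w sh (2 * ch p * w 0 it).
Proof. by rewrite (funext shE) chE; derive_with exp_leaf; field. Qed.

Ltac leaf := first [qn_leaf | notypeclasses refine (is_derive_ch _ _)
  | notypeclasses refine (is_derive_sh _ _)
  | notypeclasses refine (is_derive_mn _ _); assumption].

Definition Phi p : R^o := (1 + qn p) * mn p * ch p.

(** These are the components of the differential of [Phi]; no index is raised with the metric. *)
Definition gradPhi k p : R^o :=
  if k == it then 2 * (1 + qn p) * mn p * sh p
  else 4 * p 0 k * ch p * (mn p * mn p).

(** Makes expressions in [qn] and [mn] rational in [mn] alone, so that [field] can relate the
    two. *)
Lemma qnE p : qn p < 1 -> mn p != 0 /\ qn p = 1 - (mn p)^-1.
Proof.
move=> q1; have q0 : 1 - qn p != 0 by rewrite subr_eq0 gt_eqF.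
by split; [rewrite /mn invr_neq0|rewrite invrK subKr].
Qed.

Lemma is_derive_Phi p w : qn p < 1 ->
  is_derive p w Phi (\sum_k gradPhi k p * w 0 k).
Proof.
move=> q1; rewrite /Phi; derive_with leaf.
rewrite big_ord3 /gradPhi /= /dqn.
by have [m0 ->] := qnE q1; field.
Qed.

Definition dgcoef k p w : R :=
  if k == it then 16 * (1 + qn p) * mn p ^+ 3 * dqn p w
  else 8 * mn p ^+ 3 * dqn p w.

Lemma is_derive_gcoef k p w : qn p < 1 ->
  is_derive p w (gcoef k) (dgcoef k p w).
Proof.
move=> q1; rewrite /gcoef /dgcoef; case: (k == it); derive_with leaf.
  by have [m0 ->] := qnE q1; field.
by ring.
Qed.

Definition dgradPhi k p w : R :=
  if k == it then 4 * mn p ^+ 2 * dqn p w * sh p +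
    4 * (1 + qn p) * mn p * ch p * w 0 it
  else 4 * w 0 k * ch p * mn p ^+ 2 + 8 * p 0 k * sh p * mn p ^+ 2 * w 0 it
    + 8 * p 0 k * ch p * mn p ^+ 3 * dqn p w.

Lemma is_derive_gradPhi k p w : qn p < 1 ->
  is_derive p w (gradPhi k) (dgradPhi k p w).
Proof.
move=> q1; rewrite /gradPhi /dgradPhi; case: (k == it); derive_with leaf.
  by have [m0 ->] := qnE q1; field.
by ring.
Qed.

(* Hess Phi = Phi g in coordinates: the factor of [gradPhi k p] is the
   Christoffel term computed in [christoffel_warped]. *)
Lemma Hessian_Phi p w v : qn p < 1 ->
  \sum_k dgradPhi k p w * v 0 k -
  \sum_k gradPhi k p * (2^-1 * (gcoef k p)^-1 *
    (dgcoef k p w * v 0 k + dgcoef k p v * w 0 k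
     - \sum_a dgcoef a p (delta_mx 0 k) * w 0 a * v 0 a)) =
  Phi p * \sum_k gcoef k p * w 0 k * v 0 k.
Proof.
move=> q1; rewrite !big_ord3 /dgradPhi /gradPhi /gcoef /dgcoef /=.
rewrite /dqn !mxE /= /Phi.
have Q0 : 1 + qn p != 0 by rewrite lt0r_neq0 // ltr_pwDl ?qn_ge0.
have q0 : 1 - qn p != 0 by rewrite subr_eq0 gt_eqF.
(* Both sides are linear in [ch p] and [sh p], so these can become independent variables: the
   relation cosh^2 - sinh^2 = 1 does not enter. *)
move: Q0 q0; rewrite /mn /qn; move: (ch p) (sh p) => c s.
move: (p 0 ix) (p 0 iy) (w 0 ix) (w 0 iy) (w 0 it) (v 0 ix) (v 0 iy) (v 0 it).
move=> x y wx wy wt vx vy vt Q0 q0.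
by field; repeat (apply/andP; split => //).
Qed.

End MetricDerivative.

(** * Christoffel symbols of the warped metric *)

Section MeanCurvature.
Context {R : realType}.
Implicit Types (p w v : 'rV[R]_(2 + 1)).

Lemma gcoef_gt0 k p : qn p < 1 -> 0 < gcoef k p.
Proof.
move=> q1; have m0 : 0 < mn p by rewrite invr_gt0 subr_gt0.
have Q0 : 0 < 1 + qn p by rewrite ltr_pwDl ?qn_ge0.
by rewrite /gcoef; case: ifP => _; rewrite !mulr_gt0 ?exprn_gt0.
Qed.

Lemma inner_warped p v w : ambient p ->
  inner (warped_metric warp) p v w = \sum_k v 0 k * gcoef k p * w 0 k.
Proof.
move=> ap; rewrite /inner warped_metricE // mul_mx_diag mxE.
by apply: eq_bigr => k _; rewrite !mxE.
Qed.

Lemma near_ambient p : ambient p -> \near p, @ambient R p.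
Proof.
by move=> ap; apply: open_nbhs_nbhs; split=> //; exact: open_ambient.
Qed.

Lemma pd_warped_metric i j l p : ambient p ->
  pd i (fun q => warped_metric (@warp R) q j l : R^o) p =
  (j == l)%:R * dgcoef j p (delta_mx 0 i).
Proof.
move=> ap; have q1 : qn p < 1 by apply/ambientE.
have E : \near p, (j == l)%:R * gcoef j p = warped_metric (@warp R) p j l.
  near=> q; rewrite warped_metricE; last by near: q; exact: near_ambient.
  by rewrite !mxE; case: (j == l); rewrite ?mul1r ?mul0r.
rewrite /pd -(near_eq_derive _ E).
have [_ ->] := is_derive_mulf (is_derive_constf (j == l)%:R p (delta_mx 0 i))
  (is_derive_gcoef j (delta_mx 0 i) q1).
by rewrite mulr0 addr0.
Unshelve. all: by end_near. Qed.

Lemma invmx_diag (F : fieldType) n (d : 'rV[F]_n) : (forall k, d 0 k != 0) ->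
  invmx (diag_mx d) = diag_mx (\row_k (d 0 k)^-1).
Proof.
move=> d0; have dd : diag_mx d *m diag_mx (\row_k (d 0 k)^-1) = 1%:M.
  apply/matrixP => i j; rewrite mul_diag_mx !mxE.
  by case: (i == j); rewrite ?mulr0n ?mulr0 ?mulr1n ?divff.
have [ud _] := mulmx1_unit dd.
by rewrite -[RHS](mulKmx ud) dd mulmx1.
Qed.

(** The metric is diagonal, and so is its inverse: in the sum defining the symbol only l = k
    survives, and the Kronecker deltas of [pd_warped_metric] collapse the sums over a and b. *)
Lemma christoffel_warped p k w v : ambient p ->
  \sum_a \sum_b christoffel (warped_metric (@warp R)) p k a b * w 0 a * v 0 b =
  2^-1 * (gcoef k p)^-1 * (dgcoef k p w * v 0 k + dgcoef k p v * w 0 k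
     - \sum_a dgcoef a p (delta_mx 0 k) * w 0 a * v 0 a).
Proof.
move=> ap; have q1 : qn p < 1 by apply/ambientE.
have G0 l : gcoef l p != 0 by rewrite lt0r_neq0 // gcoef_gt0.
have E a b : christoffel (warped_metric (@warp R)) p k a b =
  2^-1 * (gcoef k p)^-1 * ((b == k)%:R * dgcoef k p (delta_mx 0 a)
   + (a == k)%:R * dgcoef k p (delta_mx 0 b)
   - (a == b)%:R * dgcoef a p (delta_mx 0 k)).
  rewrite /christoffel -mulrA; congr (_ * _).
  rewrite (bigD1 k) //= big1 ?addr0 => [|l lk].
    rewrite !pd_warped_metric // warped_metricE // invmx_diag => [|l];
      last by rewrite mxE.
    rewrite !mxE eqxx mulr1n; congr (_ * (_ + _ - _)).
      by case: eqP => [->|_]; rewrite ?mul0r.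
    by case: eqP => [->|_]; rewrite ?mul0r.
  rewrite warped_metricE // invmx_diag => [|j]; last by rewrite mxE.
  by rewrite !mxE eq_sym (negbTE lk) mulr0n mul0r.
under eq_bigr do under eq_bigr do rewrite E.
rewrite !big_ord3.
by case: (ord3P k) => ->; rewrite /dgcoef /dqn !mxE /=; field.
Qed.

End MeanCurvature.

(** * The level set of Phi and its second fundamental form *)

Section GeodesicSphere.
Context {R : realType}.
Implicit Types (p w v : 'rV[R]_(2 + 1)).

Definition geodesic_sphere (C : R) : set 'rV[R]_(2 + 1) :=
  [set p | ambient p /\ Phi p = C].

(* The inward normal - grad Phi / r, where r = |grad Phi| = sqrt (C^2 - 1). *)
Definition sphere_normal (r : R) p : 'rV[R]_(2 + 1) :=
  \row_k (- r^-1 * (if k == it then sh p * (1 - qn p) / (2 * (1 + qn p))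
                    else p 0 k * ch p)).

(** Lowering the index of the normal gives - dPhi / r, which turns inner products with the normal
    into sums against [gradPhi]. *)
Lemma sphere_normalE r k p : ambient p ->
  gcoef k p * sphere_normal r p 0 k = - r^-1 * gradPhi k p.
Proof.
move=> /ambientE q1; have [m0 qE] := qnE q1.
have Q0 : 1 + qn p != 0 by rewrite lt0r_neq0 // ltr_pwDl ?qn_ge0.
rewrite mxE /gcoef /gradPhi; case: (k == it); last by ring.
rewrite -[1 - qn p]invrK -/(mn p).
by move: (r^-1) => c; field; rewrite Q0 m0.
Qed.

Lemma elementary_mn : elementary (@ambient R) mn.
Proof.
apply: (elementaryV (f := fun p => 1 - qn p : R^o)) => [|p /ambientE q1];
  last by rewrite subr_eq0 gt_eqF.
exact: elementaryB (elementary_cst _ _) (elementary_qn _).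
Qed.

Lemma elementary_exp_height U (c : R) :
  elementary U (fun p : 'rV[R]_(2 + 1) => expR (c * p 0 it) : R^o).
Proof.
apply: elementary_expR; apply: elementaryM (elementary_cst _ c) _.
exact: elementary_coord.
Qed.

Lemma elementary_ch U : elementary U (@ch R).
Proof.
apply: elementary_eq (elementaryM (elementaryD (elementary_exp_height U 2)
  (elementary_exp_height U (-2))) (elementary_cst _ 2^-1)) _ => p _.
by rewrite chE.
Qed.

Lemma elementary_sh U : elementary U (@sh R).
Proof.
apply: elementary_eq (elementaryM (elementaryB (elementary_exp_height U 2)
  (elementary_exp_height U (-2))) (elementary_cst _ 2^-1)) _ => p _.
by rewrite shE.
Qed.

Lemma elementary_1qn U : elementary U (fun p => 1 + @qn R p).
Proof. exact: elementaryD (elementary_cst _ _) (elementary_qn _). Qed.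

Lemma elementary_Phi : elementary (@ambient R) Phi.
Proof.
apply: elementaryM (elementary_ch _).
exact: elementaryM (elementary_1qn _) elementary_mn.
Qed.

Lemma elementary_gradPhi k : elementary (@ambient R) (gradPhi k).
Proof.
rewrite /gradPhi; case: (k == it).
  apply: elementaryM (elementary_sh _); apply: elementaryM elementary_mn.
  exact: elementaryM (elementary_cst _ _) (elementary_1qn _).
apply: elementaryM (elementaryM elementary_mn elementary_mn).
apply: elementaryM (elementary_ch _).
exact: elementaryM (elementary_cst _ _) (elementary_coord _ _ _).
Qed.

(** In dPhi divided by the metric coefficients the powers of [mn] cancel up to a factor 1 - qn. The
    only denominators left are r and 2 (1 + qn), so the field is continuous on the whole space. *)
Lemma continuous_sphere_normal r : continuous (sphere_normal r).
Proof.
move=> p; apply: (@elementary_continuous_rV _ _ setT) => // [|k].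
  exact: openT.
pose F q := - r^-1 *
  (if k == it then sh q * (1 - qn q) * (2 * (1 + qn q))^-1 else q 0 k * ch q).
apply: (elementary_eq (f := F)) => [|q _]; last by rewrite mxE.
rewrite /F; apply: elementaryM (elementary_cst _ _) _.
case: (k == it); last first.
  exact: elementaryM (elementary_coord _ _ _) (elementary_ch _).
apply: elementaryM.
  apply: elementaryM (elementary_sh _) _.
  exact: elementaryB (elementary_cst _ _) (elementary_qn _).
apply: elementaryV.
  exact: elementaryM (elementary_cst _ _) (elementary_1qn _).
move=> q _; rewrite mulf_neq0 ?pnatr_eq0 //.
by rewrite lt0r_neq0 // ltr_pwDl ?qn_ge0.
Qed.

Lemma derive_comp (V W : normedModType R) (X : V -> W) (F : W -> R^o)
    (u v : V) :
  differentiable X u -> differentiable F (X u) ->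
  differentiable (F \o X) u /\ 'D_v (F \o X) u = 'D_('D_v X u) F (X u).
Proof.
move=> dX dF; have dFX := differentiable_comp dX dF; split=> //.
by rewrite !deriveE // diff_comp.
Qed.

Variables (C : R) (U : set 'rV[R]_2) (X : 'rV[R]_2 -> 'rV[R]_(2 + 1)).
Hypotheses (oU : open U) (sX : smooth_on U X).
Hypothesis XS : forall u, U u -> geodesic_sphere C (X u).

Lemma smooth_differentiable u : U u -> differentiable X u.
Proof. by move=> Uu; have [dX _] := sX 1; exact: dX. Qed.

Lemma gradPhi_tangent j u : U u ->
  \sum_k gradPhi k (X u) * pd j X u 0 k = 0.
Proof.
move=> Uu; have [aXu _] := XS Uu.
have [dPhi _] := elementary_derive open_ambient elementary_Phi.
have [_] := derive_comp (delta_mx 0 j) (smooth_differentiable Uu) (dPhi _ aXu).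
have q1 : qn (X u) < 1 by apply/ambientE.
have [_ ->] := is_derive_Phi ('D_(delta_mx 0 j) X u) q1.
move=> <-; have E : \near u, (Phi \o X) u = C.
  have : \near u, U u by apply: open_nbhs_nbhs.
  by apply: filterS => w Uw; have [] := XS Uw.
by rewrite (near_eq_derive _ E) derive_cst.
Qed.

Lemma pd_coord i j k u : U u ->
  derivable (fun u => pd j X u 0 k : R^o) u (delta_mx 0 i) /\
  'D_(delta_mx 0 i) (fun u => pd j X u 0 k : R^o) u = pd i (pd j X) u 0 k.
Proof.
move=> Uu; have [_ /(_ (delta_mx 0 j)) [dX _]] := sX 2.
have D : derivable (pd j X) u (delta_mx 0 i) by exact: diff_derivable (dX u Uu).
split; first by have /derivable_mxP/(_ 0 k) := D.
rewrite [RHS](_ : _ = ('D_(delta_mx 0 i) (pd j X) u) 0 k) //.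
by rewrite derive_mx // mxE.
Qed.

(** The derivative of the tangency relation [gradPhi_tangent] along the i-th coordinate of the
    chart, by the product rule. *)
Lemma gradPhi_pd2 i j u : U u ->
  \sum_k gradPhi k (X u) * pd i (pd j X) u 0 k =
  - \sum_k dgradPhi k (X u) (pd i X u) * pd j X u 0 k.
Proof.
move=> Uu; have [aXu _] := XS Uu; have q1 : qn (X u) < 1 by apply/ambientE.
pose F k := fun u => gradPhi k (X u) * pd j X u 0 k : R^o.
have DF k : is_derive u (delta_mx 0 i) (F k)
    (gradPhi k (X u) * pd i (pd j X) u 0 k
     + pd j X u 0 k * dgradPhi k (X u) (pd i X u)).
  have [dG _] := elementary_derive open_ambient (elementary_gradPhi k).
  have [dGX DGX] :=
    derive_comp (delta_mx 0 i) (smooth_differentiable Uu) (dG _ aXu).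
  have [DXj EXj] := pd_coord i j k Uu.
  apply: (@is_derive_mulf _ _ (gradPhi k \o X)).
    apply: DeriveDef; first exact: diff_derivable.
    by rewrite DGX; case: (is_derive_gradPhi k ('D_(delta_mx 0 i) X u) q1).
  exact: DeriveDef.
have E : \near u, (\sum_k F k) u = 0.
  have : \near u, U u by apply: open_nbhs_nbhs.
  by apply: filterS => w Uw; rewrite fct_sumE; exact: gradPhi_tangent.
have := near_eq_derive (delta_mx 0 i) E; rewrite derive_cst.
have [_ ->] := is_derive_sum DF.
rewrite big_split /= => /eqP; rewrite addr_eq0 => /eqP ->; congr (- _).
by apply: eq_bigr => k _; rewrite mulrC.
Qed.

(** By [gradPhi_pd2] and [christoffel_warped], the inner product of the covariant derivative with
    dPhi is - Hess Phi applied to the two coordinate fields. The minus sign of the inward normal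
    cancels this one, and Hess Phi = C g on the level set. *)
Lemma second_form_sphere r u : U u ->
  second_form (warped_metric warp) (sphere_normal r) X u =
  (r^-1 * C) *: first_form (warped_metric warp) X u.
Proof.
move=> Uu; have [aXu PhiC] := XS Uu; have q1 : qn (X u) < 1 by apply/ambientE.
apply/matrixP => i j; rewrite !mxE !inner_warped //.
have G0 l : gcoef l (X u) != 0 by rewrite lt0r_neq0 // gcoef_gt0.
under eq_bigr => k _ do rewrite -mulrA sphere_normalE // mulrCA mxE
  [X in _ + X]mxE christoffel_warped // mulrDl.
rewrite -mulr_sumr big_split /=.
have := gradPhi_pd2 i j Uu.
under eq_bigr => k _ do rewrite mulrC.
move=> ->.
have := Hessian_Phi (pd i X u) (pd j X u) q1.
rewrite PhiC => H.
under [X in _ * (_ + X)]eq_bigr => k _ do rewrite mulrC.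
rewrite mulNr -mulrN opprD opprK H mulrA.
by congr (_ * _); apply: eq_bigr => k _; rewrite [gcoef _ _ * _]mulrC.
Qed.

End GeodesicSphere.

(** * Unit normal and mean curvature of the level set *)

Section ConstantMeanCurvature.
Context {R : realType}.
Implicit Types p : 'rV[R]_(2 + 1).

(** The first form is J g J^T. A vector v in its kernel makes v J of length zero, so v J = 0 as g is
    positive definite, and v = 0 as J is injective. *)
Lemma first_form_unit (X : 'rV[R]_2 -> 'rV[R]_(2 + 1)) u :
  differentiable X u -> row_free ('J X u) -> ambient (X u) ->
  first_form (warped_metric warp) X u \in unitmx.
Proof.
move=> dX fJ aXu; rewrite -row_free_unit; apply: inj_row_free => v vI0.
set J := 'J X u; set g := warped_metric warp (X u).
have IE : first_form (warped_metric warp) X u = J *m g *m J^T.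
  apply/matrixP => i j; rewrite !mxE /inner /pd !deriveEjacobian // -!rowE.
  rewrite -/J -/g -row_mul mxE; apply: eq_bigr => k _.
  by rewrite [_ 0 k]mxE ![_^T _ _]mxE [row _ _ _ _]mxE.
have : inner (warped_metric warp) (X u) (v *m J) (v *m J) = 0.
  have := congr1 (fun y => (y *m v^T) 0 0) vI0.
  by rewrite /= IE mul0mx [X in _ = X]mxE /inner trmx_mul !mulmxA.
have q1 : qn (X u) < 1 by apply/ambientE.
rewrite inner_warped // => /eqP; rewrite psumr_eq0 => [/allP w0|k _]; last first.
  by rewrite mulrAC -expr2 mulr_ge0 ?sqr_ge0 // ltW // gcoef_gt0.
have vJ0 : v *m J = 0.
  apply/rowP => k; have := w0 k (mem_index_enum _).
  rewrite mulrAC mulf_eq0 [gcoef _ _ == 0]gt_eqF ?gcoef_gt0 // orbF mulf_eq0 orbb.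
  by move=> /eqP ->; rewrite [RHS]mxE.
by apply: (row_free_inj fJ); rewrite vJ0 mul0mx.
Qed.

Lemma geodesic_sphere_cmc (C r : R) : 0 < r -> C ^+ 2 = 1 + r ^+ 2 ->
  constant_mean_curvature (warped_metric warp) (geodesic_sphere C) (r^-1 * C).
Proof.
move=> r0 Cr; exists (sphere_normal r); split.
  split.
  - apply: continuous_subspaceT; exact: continuous_sphere_normal.
  - move=> p [ap PhiC]; rewrite inner_warped //.
    under eq_bigr do rewrite -mulrA sphere_normalE //.
    have q1 : qn p < 1 by apply/ambientE.
    have Q0 : 1 + qn p != 0 by rewrite lt0r_neq0 // ltr_pwDl ?qn_ge0.
    have q0 : 1 - qn p != 0 by rewrite subr_eq0 gt_eqF.
    have cs : ch p ^+ 2 = 1 + sh p ^+ 2 by exact: cosh2_sinh2.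
    (* The normal is a unit vector because |grad Phi|^2 = Phi^2 - 1, that is sinh^2 = cosh^2 - 1 for
       the distance to the origin; this is r^2 on the level set. *)
    have rE : r ^+ 2 = ((1 + qn p) * (1 - qn p)^-1 * ch p) ^+ 2 - 1.
      by rewrite -[_ * ch p]/(Phi p) PhiC Cr; ring.
    have r1 : r != 0 by rewrite gt_eqF.
    suff : \sum_k sphere_normal r p 0 k * (- r^-1 * gradPhi k p) =
        r ^- 2 * r ^+ 2.
      by move=> ->; rewrite mulVf // expf_eq0.
    rewrite [X in _ = _ * X]rE big_ord3 /gradPhi !mxE /= /qn /mn exprMn cs.
    move: Q0 q0; rewrite /qn.
    move: (p 0 ix) (p 0 iy) (sh p) cs => x y s cs Q0 q0.
    transitivity (r ^- 2 * (4 * (x ^+ 2 + y ^+ 2) * (ch p) ^+ 2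
      * (1 - (x ^+ 2 + y ^+ 2)) ^- 2 + s ^+ 2)).
      by rewrite -exprVn; move: (r^-1) => k; field; rewrite Q0 q0.
    by rewrite cs; move: (r ^- 2) => k; field; rewrite q0.
  - move=> U X [oU sX _ _ [W [_ XW]]] u Uu i.
    have XS w : U w -> geodesic_sphere C (X w).
      by move=> Uw; have : (X @` U) (X w) by [exists w]; rewrite XW => -[].
    have [aXu _] := XS u Uu.
    rewrite inner_warped //.
    under eq_bigr do rewrite -mulrA sphere_normalE // mulrCA.
    rewrite -mulr_sumr; under eq_bigr do rewrite mulrC.
    by rewrite (gradPhi_tangent oU sX XS) // mulr0.
move=> U X [oU sX fJ _ [W [_ XW]]] u Uu.
have XS w : U w -> geodesic_sphere C (X w).
  by move=> Uw; have : (X @` U) (X w) by [exists w]; rewrite XW => -[].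
have [aXu _] := XS u Uu.
rewrite /mean_curvature (second_form_sphere oU sX XS) // -scalemxAr.
rewrite mulVmx; last first.
  exact: first_form_unit (smooth_differentiable sX Uu) (fJ u Uu) aXu.
by rewrite mxtraceZ mxtrace1 mulrC mulfK // pnatr_eq0.
Qed.

End ConstantMeanCurvature.

(** * Charts *)

Section Arcosh.
Context {R : realType}.
Implicit Types x y : R.

Lemma coshN x : cosh (- x) = cosh x.
Proof. by rewrite /cosh opprK addrC. Qed.

Lemma cosh_sinh x : cosh x + sinh x = expR x.
Proof. by rewrite /cosh /sinh; field. Qed.

Lemma sinh_ge0 x : 0 <= x -> 0 <= sinh x.
Proof. by move=> x0; rewrite /sinh divr_ge0 // subr_ge0 ler_expR; lra. Qed.

Lemma sinh_gt0 x : 0 < x -> 0 < sinh x.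
Proof. by move=> x0; rewrite /sinh divr_gt0 // subr_gt0 ltr_expR; lra. Qed.

Lemma cosh_gt0 x : 0 < cosh x.
Proof. by rewrite /cosh divr_gt0 // addr_gt0 // expR_gt0. Qed.

Lemma cosh_ge1 x : 1 <= cosh x.
Proof.
have := cosh_gt0 x; have := cosh2_sinh2 x; have := sqr_ge0 (sinh x).
by rewrite expr2; nra.
Qed.

Lemma cosh_gt1 x : 0 < x -> 1 < cosh x.
Proof.
move=> /sinh_gt0 s0; have := cosh_ge1 x; have := cosh2_sinh2 x.
by rewrite !expr2; nra.
Qed.

Definition arcosh y : R := ln (y + Num.sqrt (y ^+ 2 - 1)).

Lemma coshK x : 0 <= x -> arcosh (cosh x) = x.
Proof.
move=> x0; rewrite /arcosh cosh2_sinh2 addrAC subrr add0r sqrtr_sqr.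
by rewrite ger0_norm ?sinh_ge0 // cosh_sinh expRK.
Qed.

Lemma arcosh_arg_gt0 y : 1 <= y -> 0 < y + Num.sqrt (y ^+ 2 - 1).
Proof. by move=> y1; have := sqrtr_ge0 (y ^+ 2 - 1); lra. Qed.

Lemma arcoshK y : 1 <= y -> cosh (arcosh y) = y.
Proof.
move=> y1; have a0 := arcosh_arg_gt0 y1.
rewrite /cosh /arcosh expRN lnK ?posrE //.
have y20 : 0 <= y ^+ 2 - 1 by rewrite expr2; nra.
move: (sqr_sqrtr y20) a0; set s := Num.sqrt _ => ss a0.
have ys : (y + s)^-1 = y - s.
  apply: (mulfI (lt0r_neq0 a0)).
  by rewrite divff ?lt0r_neq0 // mulrC -subr_sqr ss; ring.
by rewrite ys; field.
Qed.

Lemma arcosh_gt0 y : 1 < y -> 0 < arcosh y.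
Proof.
by move=> y1; rewrite ln_gt0 //; have := sqrtr_ge0 (y ^+ 2 - 1); lra.
Qed.

Lemma arcosh1 : arcosh 1 = 0.
Proof. by rewrite /arcosh expr1n subrr sqrtr0 addr0 ln1. Qed.

Lemma elementary_cosh (V : normedModType R) (U : set V) (f : V -> R^o) :
  elementary U f -> elementary U (fun v => cosh (f v)).
Proof.
move=> ef; apply: elementaryM _ (elementary_cst _ 2^-1).
by apply: elementaryD; apply: elementary_expR => //; exact: elementaryN.
Qed.

End Arcosh.

Section Charts.
Context {R : realType}.
Variable C : R.
Hypothesis C1 : 1 < C.

(** The cleared equation also implies membership in the ambient space: its left side is positive and
    C > 0, which forces qn < 1. *)
Lemma geodesic_sphereE (p : 'rV[R]_(2 + 1)) :
  geodesic_sphere C p <-> (1 + qn p) * ch p = C * (1 - qn p).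
Proof.
have ch0 : 0 < ch p := cosh_gt0 _; have Q0 := qn_ge0 p.
split=> [[/ambientE q1 <-]|E].
  by rewrite /Phi /mn; field; rewrite subr_eq0 gt_eqF.
have C0 : 0 < C by rewrite (lt_trans _ C1).
have q1 : qn p < 1.
  by rewrite -subr_gt0 -(pmulr_rgt0 _ C0) -E mulr_gt0 // ltr_pwDl.
split; first exact/ambientE.
rewrite /Phi /mn mulrAC E mulfK // subr_eq0 gt_eqF //.
Qed.

(* The value of cosh (2 t) at the points of the sphere above u. *)
Definition cosh_level (u : 'rV[R]_2) : R^o :=
  C * (1 - sqnorm u) / (1 + sqnorm u).

Lemma sqnorm_ge0 n (x : 'rV[R]_n) : 0 <= sqnorm x.
Proof. by apply: sumr_ge0 => i _; exact: sqr_ge0. Qed.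

Lemma elementary_sqnorm n U : elementary U (fun x : 'rV[R]_n => sqnorm x : R^o).
Proof.
by apply: elementary_sum => i; apply: elementary_sqr; exact: elementary_coord.
Qed.

Lemma elementary_cosh_level U : elementary U cosh_level.
Proof.
have es := elementary_sqnorm (n := 2) U.
apply: elementaryM.
  exact: elementaryM (elementary_cst _ _) (elementaryB (elementary_cst _ _) es).
apply: elementaryV => [|u _]; first exact: elementaryD (elementary_cst _ _) es.
by rewrite lt0r_neq0 // ltr_pwDl ?sqnorm_ge0.
Qed.

(** The inequality is strict to exclude the equator, where the square root inside arcosh vanishes
    and is not differentiable. *)
Definition cap : set 'rV[R]_2 := [set u | 1 < cosh_level u].

Definition cap_height (u : 'rV[R]_2) : R^o := arcosh (cosh_level u) / 2.

Lemma open_cap : open cap.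
Proof.
have -> : cap = [set u | 0 < cosh_level u - 1].
  by apply/funext => u; apply/propext; rewrite /= subr_gt0.
apply: open_elementary_gt0.
exact: elementaryB (elementary_cosh_level _) (elementary_cst _ _).
Qed.

Lemma elementary_cap_height : elementary cap cap_height.
Proof.
apply: elementaryM _ (elementary_cst _ _).
have ey := elementary_cosh_level cap.
apply: elementary_ln => [|u /ltW/arcosh_arg_gt0 //].
apply: (elementaryD ey); apply: elementary_sqrt => [|u].
  exact: elementaryB (elementary_sqr ey) (elementary_cst _ _).
by rewrite /cap /= => y1; rewrite expr2; nra.
Qed.

Lemma cap_chart (s : R) : s * s = 1 ->
  local_parametrization (geodesic_sphere C) cap (graph_map ix iy s cap_height) /\
  graph_map ix iy s cap_height @` cap =
    geodesic_sphere C `&` [set p | 0 < s * p 0 it].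
Proof.
move=> ss; have s1 : s = 1 \/ s = -1.
  have : s ^+ 2 == 1 ^+ 2 by rewrite expr1n expr2 ss.
  by rewrite eqf_sqr => /orP[/eqP|/eqP]; [left|right].
have coshs (x : R) : cosh (2 * (s * x)) = cosh (2 * x).
  by case: s1 => ->; rewrite ?mul1r // mulN1r mulrN coshN.
apply: graph_chart => //.
- by move=> k; case: (ord3P k) => ->.
- exact: open_cap.
- exact: elementary_cap_height.
- move=> u Uu; have h0 : 0 < cap_height u by rewrite divr_gt0 // arcosh_gt0.
  split=> //; apply/geodesic_sphereE.
  rewrite /ch /qn !mxE /= coshs /cap_height [2 * _]mulrC divfK // arcoshK ?ltW //.
  rewrite /cosh_level sqnorm2.
  by field; rewrite -sqnorm2 lt0r_neq0 // ltr_pwDl ?sqnorm_ge0.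
- move=> p /geodesic_sphereE Sp t0.
  have sq : sqnorm (graph_proj ix iy p) = qn p by rewrite sqnorm2 !mxE.
  have Q0 : 1 + qn p != 0 by rewrite lt0r_neq0 // ltr_pwDl ?qn_ge0.
  have lE : cosh_level (graph_proj ix iy p) = cosh (2 * (s * p 0 it)).
    by rewrite coshs /cosh_level sq -Sp mulrC mulKf.
  have st0 : 0 < 2 * (s * p 0 it) by rewrite mulr_gt0.
  rewrite /cap /cap_height /= lE; split; first exact: cosh_gt1.
  by rewrite coshK ?ltW // [2 * _]mulrC mulfK // mulrA ss mul1r.
Qed.

(* On the sphere, |x|^2 = (C - cosh (2 t)) / (C + cosh (2 t)). *)
Definition side_radicand (u : 'rV[R]_2) : R^o :=
  (C - cosh (2 * u 0 1)) / (C + cosh (2 * u 0 1)) - u 0 0 ^+ 2.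

Lemma elementary_side_radicand U : elementary U side_radicand.
Proof.
have ec : elementary U (fun u : 'rV[R]_2 => cosh (2 * u 0 1) : R^o).
  apply: elementary_cosh; apply: elementaryM (elementary_cst _ _) _.
  exact: elementary_coord.
apply: elementaryB; last by apply: elementary_sqr; exact: elementary_coord.
apply: elementaryM; first exact: elementaryB (elementary_cst _ _) ec.
apply: elementaryV => [|u _]; first exact: elementaryD (elementary_cst _ _) ec.
by rewrite lt0r_neq0 // addr_gt0 ?cosh_gt0 // (lt_trans _ C1).
Qed.

(** Solves for the horizontal coordinate c in terms of the other one and of the height. The height
    may vanish here, so these charts cover the equator. *)
Lemma side_chart (a c : 'I_(2 + 1)) (s : R) : s * s = 1 ->
  [|| (a == ix) && (c == iy) | (a == iy) && (c == ix)] ->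
  let U := [set u | 0 < side_radicand u] in
  let phi := fun u => Num.sqrt (side_radicand u) : R^o in
  local_parametrization (geodesic_sphere C) U (graph_map a it s phi) /\
  graph_map a it s phi @` U = geodesic_sphere C `&` [set p | 0 < s * p 0 c].
Proof.
move=> ss ac U phi.
have qE (p : 'rV[R]_(2 + 1)) : qn p = p 0 a ^+ 2 + p 0 c ^+ 2.
  by case/orP: ac => /andP[/eqP -> /eqP ->] //; rewrite /qn addrC.
have Cc (p : 'rV[R]_(2 + 1)) : C + ch p != 0.
  by rewrite lt0r_neq0 // addr_gt0 ?cosh_gt0 // (lt_trans _ C1).
have SE (p : 'rV[R]_(2 + 1)) : geodesic_sphere C p <->
    qn p = (C - ch p) / (C + ch p).
  rewrite geodesic_sphereE; split=> H.
    apply: (mulIf (Cc p)); rewrite divfK //.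
    by rewrite -[LHS]addr0 -(subrr ((1 + qn p) * ch p)) {1}H; ring.
  by rewrite H; field; exact: Cc.
have oU : open U by apply: open_elementary_gt0; exact: elementary_side_radicand.
apply: graph_chart => //.
- by case/orP: ac => /andP[/eqP ea /eqP ec]; rewrite ?ea ?ec.
- by case/orP: ac => /andP[/eqP ea /eqP ec]; rewrite ?ea ?ec.
- by case/orP: ac => /andP[/eqP ea /eqP ec]; rewrite ?ea ?ec.
- move=> k; case/orP: ac => /andP[/eqP ea /eqP ec]; rewrite ?ea ?ec;
  by case: (ord3P k) => ->.
- apply: elementary_sqrt => //; exact: elementary_side_radicand.
- move=> u Uu; split; first by rewrite sqrtr_gt0.
  apply/SE; rewrite qE /ch !mxE eqxx.
  have [-> -> ->] : [/\ (it == a) = false, (c == a) = false & (c == it) = false].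
    by case/orP: ac => /andP[/eqP ea /eqP ec]; rewrite ?ea ?ec.
  rewrite exprMn [s ^+ 2]expr2 ss mul1r sqr_sqrtr ?ltW //.
  by rewrite /side_radicand addrC subrK.
- move=> p /SE Sp c0.
  have rE : side_radicand (graph_proj a it p) = (s * p 0 c) ^+ 2.
    rewrite /side_radicand !mxE /= -[cosh _]/(ch p) -Sp qE exprMn [s ^+ 2]expr2 ss.
    by ring.
  rewrite /U /phi /= rE exprn_gt0 // sqrtr_sqr gtr0_norm //.
  by split=> //; rewrite mulrA ss mul1r.
Qed.

Lemma embedded_geodesic_sphere : embedded_surface (geodesic_sphere C).
Proof.
move=> p Sp.
have sgP (x : R) : x != 0 -> exists2 s : R, s * s = 1 & 0 < s * x.
  by case: ltrgt0P => // x0 _; [exists 1|exists (-1)];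
    rewrite ?mulrNN ?mul1r // mulN1r oppr_gt0.
have [t0|/sgP [s ss st]] := eqVneq (p 0 it) 0; last first.
  have [L im] := cap_chart ss; exists cap, (graph_map ix iy s cap_height).
  by rewrite im.
(* At height 0 the origin has Phi = 1 < C, so a point of the equator has a nonzero horizontal
   coordinate. *)
have q0 : qn p != 0.
  move/geodesic_sphereE: Sp; apply: contraPneq => ->.
  rewrite /ch t0 mulr0 /cosh oppr0 expR0 => /eqP.
  by rewrite addr0 mul1r mulr1 -mulr2n divff ?pnatr_eq0 // lt_eqF.
have [y0|/sgP [s ss sy]] := eqVneq (p 0 iy) 0; last first.
  have [L im] := @side_chart ix iy s ss isT.
  by eexists; eexists; split; [exact: L|rewrite im].
have x0 : p 0 ix != 0.
  move: q0; rewrite /qn y0 expr0n addr0; apply: contraNneq => ->.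
  by rewrite expr0n.
have [s ss sx] := sgP _ x0.
have [L im] := @side_chart iy ix s ss isT.
by eexists; eexists; split; [exact: L|rewrite im].
Qed.

End Charts.

(** * Homeomorphism with the unit sphere *)

Section SphereHomeomorphism.
Context {R : realType}.
Variables (C r : R).
Hypotheses (C1 : 1 < C) (r0 : 0 < r) (Cr : C ^+ 2 = 1 + r ^+ 2).
Implicit Types x p : 'rV[R]_(2 + 1).

Lemma sqnorm3 x : sqnorm x = x 0 ix ^+ 2 + x 0 iy ^+ 2 + x 0 it ^+ 2.
Proof. exact: big_ord3. Qed.

(* Height and Euclidean norm, in the upper half-space model, of the point of the
   Euclidean sphere of centre (0, 0, C) and radius r in the direction x. *)
Definition hs_height x : R^o := C + r * x 0 it.
Definition hs_norm x : R^o := Num.sqrt (2 * C * hs_height x - 1).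

(** From half-space to cylindrical coordinates: the Euclidean norm is e^(2 t), and the direction is
    projected stereographically from the hemisphere to the disc. *)
Definition from_sphere x : 'rV[R]_(2 + 1) :=
  \row_k (if k == it then ln (hs_norm x) / 2
          else r * x 0 k / (hs_norm x + hs_height x)).

(** The point (2 x, 1 - |x|^2) / (1 + |x|^2) of the unit hemisphere is scaled by e^(2 t); the
    Euclidean sphere so obtained is then recentred and divided by its radius. *)
Definition to_sphere p : 'rV[R]_(2 + 1) :=
  \row_k ((if k == it then expR (2 * p 0 it) * (1 - qn p) / (1 + qn p) - C
           else expR (2 * p 0 it) * (2 * p 0 k) / (1 + qn p)) / r).

(** An open set that contains the unit sphere, as [hs_norm_sphere] shows, and on which the logarithm
    and the denominators of [from_sphere] are regular. *)
Let hs_domain : set 'rV[R]_(2 + 1) :=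
  [set x | 0 < hs_height x] `&` [set x | 0 < 2 * C * hs_height x - 1].

Lemma elementary_hs_height U : elementary U hs_height.
Proof.
apply: elementaryD (elementary_cst _ _) _.
exact: elementaryM (elementary_cst _ _) (elementary_coord _ _ _).
Qed.

Lemma elementary_hs_radicand U :
  elementary U (fun x => 2 * C * hs_height x - 1 : R^o).
Proof.
apply: elementaryB (elementary_cst _ _).
exact: elementaryM (elementary_cst _ _) (elementary_hs_height _).
Qed.

Lemma open_hs_domain : open hs_domain.
Proof.
by apply: openI; apply: open_elementary_gt0;
  [exact: elementary_hs_height|exact: elementary_hs_radicand].
Qed.

Lemma continuous_from_sphere x : hs_domain x -> {for x, continuous from_sphere}.
Proof.
have en : elementary hs_domain hs_norm.
  by apply: elementary_sqrt => [|y [] //]; exact: elementary_hs_radicand.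
have n0 y : hs_domain y -> 0 < hs_norm y by move=> [_ ?]; rewrite sqrtr_gt0.
apply: elementary_continuous_rV open_hs_domain _ => k.
pose F (y : 'rV[R]_(2 + 1)) : R^o := if k == it then ln (hs_norm y) / 2
                  else r * y 0 k / (hs_norm y + hs_height y).
apply: (elementary_eq (f := F)) => [|y _]; last by rewrite mxE.
rewrite /F; case: (k == it).
  exact: elementaryM (elementary_ln en n0) (elementary_cst _ _).
apply: elementaryM.
  exact: elementaryM (elementary_cst _ _) (elementary_coord _ _ _).
apply: elementaryV => [|y Dy].
  exact: elementaryD en (elementary_hs_height _).
by rewrite lt0r_neq0 // addr_gt0 ?n0 //; have [] := Dy.
Qed.

Lemma continuous_to_sphere : continuous to_sphere.
Proof.
move=> p; apply: (@elementary_continuous_rV _ _ setT) => // [|k].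
  exact: openT.
have e1q : elementary setT (fun p => (1 + @qn R p)^-1 : R^o).
  apply: elementaryV => [|q _]; first exact: elementary_1qn.
  by rewrite lt0r_neq0 // ltr_pwDl ?qn_ge0.
pose F (q : 'rV[R]_(2 + 1)) : R^o :=
  (if k == it then expR (2 * q 0 it) * (1 - qn q) / (1 + qn q) - C
   else expR (2 * q 0 it) * (2 * q 0 k) / (1 + qn q)) / r.
apply: (elementary_eq (f := F)) => [|q _]; last by rewrite mxE.
rewrite /F; apply: elementaryM _ (elementary_cst _ _); case: (k == it).
  apply: elementaryB (elementary_cst _ _); apply: elementaryM e1q.
  apply: elementaryM; first exact: elementary_exp_height.
  exact: elementaryB (elementary_cst _ _) (elementary_qn _).
apply: elementaryM e1q; apply: elementaryM; first exact: elementary_exp_height.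
exact: elementaryM (elementary_cst _ _) (elementary_coord _ _ _).
Qed.

(** For a point P of height h, |P - (0, 0, C)|^2 = r^2 = C^2 - 1 expands to |P|^2 = 2 C h - 1, the
    radicand of [hs_norm]. The height is positive because r < C. *)
Lemma hs_norm_sphere x : sqnorm x = 1 ->
  [/\ 0 < hs_height x, 0 < hs_norm x, hs_norm x ^+ 2 = 2 * C * hs_height x - 1
    & r ^+ 2 * (x 0 ix ^+ 2 + x 0 iy ^+ 2) = hs_norm x ^+ 2 - hs_height x ^+ 2].
Proof.
rewrite sqnorm3 => x1; set n2 := x 0 ix ^+ 2 + x 0 iy ^+ 2 in x1 *.
have n20 : 0 <= n2 by rewrite addr_ge0 ?sqr_ge0.
have h0 : 0 < hs_height x.
  have rC : r < C.
    rewrite -(@ltr_pXn2r _ 2) ?nnegrE ?(ltW r0) ?(ltW (lt_trans _ C1)) //.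
    by rewrite Cr ltrDr.
  have z1 : -1 <= x 0 it.
    by move: (x 0 it) x1 n20 => z; clearbody n2; rewrite expr2 => zz n20; nra.
  have -> : hs_height x = (C - r) + r * (1 + x 0 it).
    by rewrite /hs_height; ring.
  by rewrite ltr_pwDl ?subr_gt0 // (mulr_ge0 (ltW r0)) // -lerBlDl sub0r.
have rE : 2 * C * hs_height x - 1 = hs_height x ^+ 2 + r ^+ 2 * n2.
  have -> : n2 = 1 - x 0 it ^+ 2 by rewrite -x1 addrK.
  by rewrite /hs_height; ring: Cr.
have r0' : 0 < 2 * C * hs_height x - 1.
  by rewrite rE ltr_pwDl ?exprn_gt0 // mulr_ge0 ?sqr_ge0.
have nE : hs_norm x ^+ 2 = 2 * C * hs_height x - 1 by rewrite sqr_sqrtr ?ltW.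
by split=> //; [rewrite sqrtr_gt0|rewrite nE rE addrC addKr].
Qed.

Lemma from_sphereE x : sqnorm x = 1 ->
  [/\ qn (from_sphere x) =
        (hs_norm x - hs_height x) / (hs_norm x + hs_height x),
      expR (2 * from_sphere x 0 it) = hs_norm x
    & geodesic_sphere C (from_sphere x)].
Proof.
move=> /hs_norm_sphere[h0 w0 wE nE].
have wh0 : hs_norm x + hs_height x != 0 by rewrite lt0r_neq0 // addr_gt0.
have qE : qn (from_sphere x) =
    (hs_norm x - hs_height x) / (hs_norm x + hs_height x).
  rewrite /qn !mxE /= !expr_div_n !exprMn -mulrDl -mulrDr nE subr_sqr.
  by field.
have tE : 2 * from_sphere x 0 it = ln (hs_norm x).
  by rewrite mxE eqxx mulrC divfK.
split=> //; first by rewrite tE lnK.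
apply/(geodesic_sphereE C1); rewrite qE /ch tE /cosh expRN lnK //.
have wn0 : hs_norm x != 0 by rewrite gt_eqF.
(* Eliminating C leaves an identity between rational functions of the norm and the height. *)
have CE : C = (hs_norm x ^+ 2 + 1) / (2 * hs_height x).
  by rewrite wE; field; rewrite gt_eqF.
rewrite [X in _ = X * _]CE; field; rewrite wh0 wn0 /= lt0r_neq0 //.
Qed.

Lemma from_sphereK x : sqnorm x = 1 -> to_sphere (from_sphere x) = x.
Proof.
move=> x1; have [qE eE _] := from_sphereE x1.
have [h0 w0 wE nE] := hs_norm_sphere x1.
have wh0 : hs_norm x + hs_height x != 0 by rewrite lt0r_neq0 // addr_gt0.
have wn0 : hs_norm x != 0 by rewrite gt_eqF.
have w2 : hs_norm x + hs_height x + (hs_norm x - hs_height x) != 0.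
  by rewrite addrACA subrr addr0 -mulr2n mulrn_eq0.
have rn0 : r != 0 by rewrite gt_eqF.
apply/rowP => k; rewrite mxE eE qE; case: eqP => [->|/eqP kt].
  rewrite [X in X - C](_ : _ = hs_height x); first by rewrite /hs_height; field.
  by field; rewrite wh0 w2.
by rewrite mxE (negbTE kt); field; rewrite rn0 wh0 w2.
Qed.

Lemma to_sphereK p : geodesic_sphere C p ->
  sqnorm (to_sphere p) = 1 /\ from_sphere (to_sphere p) = p.
Proof.
move=> /(geodesic_sphereE C1); rewrite /ch /cosh expRN.
set w := expR _ => pS; have w0 : 0 < w := expR_gt0 _.
have Q0 : 1 + qn p != 0 by rewrite lt0r_neq0 // ltr_pwDl ?qn_ge0.
have wn0 : w != 0 by rewrite gt_eqF.
have rn0 : r != 0 by rewrite gt_eqF.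
(* The sphere equation in w = e^(2 t). Divided by 1 + qn, it says w^2 + 1 = 2 C h with h the
   half-space height. *)
have wE : (w ^+ 2 + 1) * (1 + qn p) = 2 * C * w * (1 - qn p).
  transitivity (2 * w * ((1 + qn p) * ((w + w^-1) / 2))); first by field.
  by rewrite pS; ring.
have r2 : r ^+ 2 = C ^+ 2 - 1 by rewrite Cr addrC addKr.
have hE : hs_height (to_sphere p) = w * (1 - qn p) / (1 + qn p).
  by rewrite /hs_height mxE eqxx -/w mulrC divfK // addrC subrK.
have nE : hs_norm (to_sphere p) = w.
  rewrite /hs_norm hE.
  have -> : 2 * C * (w * (1 - qn p) / (1 + qn p)) - 1 = w ^+ 2.
    by rewrite !mulrA -wE; field.
  by rewrite sqrtr_sqr gtr0_norm.
split.
  have : r ^+ 2 * sqnorm (to_sphere p) = r ^+ 2 * 1; last first.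
    by apply: mulfI; rewrite expf_eq0.
  have sc (a b c : R) :
      r ^+ 2 * ((a / r) ^+ 2 + (b / r) ^+ 2 + (c / r) ^+ 2) =
      a ^+ 2 + b ^+ 2 + c ^+ 2.
    by field.
  rewrite mulr1 sqnorm3 !mxE /= -/w sc.
  have hw : 2 * C * (w * (1 - qn p) / (1 + qn p)) = w ^+ 2 + 1.
    by rewrite !mulrA -wE; field.
  have -> : (w * (2 * p 0 ix) / (1 + qn p)) ^+ 2
     + (w * (2 * p 0 iy) / (1 + qn p)) ^+ 2
     = w ^+ 2 - (w * (1 - qn p) / (1 + qn p)) ^+ 2.
    by move: Q0; rewrite /qn => Q0; field.
  by rewrite r2 -[w ^+ 2](addrK 1) -hw; ring.
apply/rowP => k; rewrite mxE nE hE; case: eqP => [->|/eqP kt].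
  by rewrite expRK mulrAC divff ?mul1r.
rewrite mxE (negbTE kt) -/w.
have w2 : w * (1 + qn p) + w * (1 - qn p) != 0.
  by rewrite -mulrDr addrACA subrr addr0 mulf_neq0.
by field; rewrite rn0 Q0 w2.
Qed.

Lemma homeomorphic_sphere : homeomorphic (@unit_sphere2 R) (geodesic_sphere C).
Proof.
exists from_sphere; split; [|split].
- apply: for_within_continuous => x /hs_norm_sphere[h0 w0 wE _].
  apply: continuous_from_sphere; split=> //.
  by rewrite /= -wE exprn_gt0.
- rewrite eqEsubset; split=> [_ [x /= x1 <-]|p Sp].
    by have [] := from_sphereE x1.
  by have [x1 xp] := to_sphereK Sp; exists (to_sphere p).
- exists to_sphere; split; last by move=> x /from_sphereK.
  exact: continuous_subspaceT continuous_to_sphere.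
Qed.

End SphereHomeomorphism.

(** * Symmetries and the bi-graph *)

Section Symmetry.
Context {R : realType}.
Implicit Types (u : 'rV[R]_2) (p : 'rV[R]_(2 + 1)).

Lemma point_base_height p : Defs.point (base p) (height p) = p.
Proof.
rewrite /Defs.point (_ : const_mx _ = rsubmx p) ?hsubmxK //.
by apply/rowP => i; rewrite mxE /height ord1.
Qed.

Lemma base_point u (t : R) : base (Defs.point u t) = u.
Proof. exact: row_mxKl. Qed.

Lemma height_point u (t : R) : height (Defs.point u t) = t.
Proof. by rewrite /height row_mxKr mxE. Qed.

(** Membership depends only on |x| and cosh (2 t), which rotations preserve. *)
Lemma geodesic_sphere_base C p q : sqnorm (base p) = sqnorm (base q) ->
  cosh (2 * height p) = cosh (2 * height q) ->
  geodesic_sphere C p -> geodesic_sphere C q.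
Proof.
move=> bE hE; rewrite /geodesic_sphere /ambient /disc /Phi /mn /ch /qn /=.
by rewrite -!sqnorm_base -!heightE bE hE.
Qed.

Lemma sqnorm_rotate a u : sqnorm (rotate a u) = sqnorm u.
Proof.
have := cos2Dsin2 a; rewrite !sqnorm2 !mxE /=.
move: (cos a) (sin a) (u 0 0) (u 0 1) => c s x y cs.
transitivity ((c ^+ 2 + s ^+ 2) * (x ^+ 2 + y ^+ 2)); first by ring.
by rewrite cs mul1r.
Qed.

Lemma rotateK a : cancel (rotate (- a)) (rotate a : 'rV[R]_2 -> 'rV[R]_2).
Proof.
move=> u; have cs := cos2Dsin2 a.
apply/rowP => j; rewrite !mxE /= cosN sinN.
have [->|->] := ord2P j; rewrite /= -[RHS]mul1r -cs; ring.
Qed.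

Lemma rotation_invariant_geodesic_sphere (C : R) :
  rotation_invariant (geodesic_sphere C).
Proof.
move=> a; rewrite eqEsubset; split=> [_ [p Sp <-]|p Sp].
  by apply: geodesic_sphere_base Sp;
    rewrite ?base_point ?height_point ?sqnorm_rotate.
exists (Defs.point (rotate (- a) (base p)) (height p)).
  by apply: geodesic_sphere_base Sp;
    rewrite ?base_point ?height_point ?sqnorm_rotate.
by rewrite base_point height_point rotateK point_base_height.
Qed.

Lemma vertical_translate0 (S : set 'rV[R]_(2 + 1)) : vertical_translate 0 S = S.
Proof.
rewrite /vertical_translate -[RHS]image_id; congr (image _ _).
by apply/funext => p; rewrite addr0 point_base_height.
Qed.

End Symmetry.

Section BiGraph.
Context {R : realType}.
Variable C : R.
Hypothesis C1 : 1 < C.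
Implicit Types u : 'rV[R]_2.

(** The squared Euclidean radius of the equator, tanh^2 (d / 2) for C = cosh d. *)
Let k := (C - 1) / (C + 1).

Lemma cap_radius_gt0 : 0 < k.
Proof. by rewrite /k divr_gt0 ?subr_gt0 // addr_gt0 // (lt_trans _ C1). Qed.

Lemma cosh_level_ge1 u : (1 <= cosh_level C u) = (sqnorm u <= k).
Proof.
have C10 : 0 < C + 1 by rewrite addr_gt0 // (lt_trans _ C1).
rewrite ler_pdivlMr ?ltr_pwDl ?sqnorm_ge0 // ler_pdivlMr //.
by rewrite -subr_ge0 -[RHS]subr_ge0; congr (0 <= _); ring.
Qed.

Lemma cosh_level_gt1 u : (1 < cosh_level C u) = (sqnorm u < k).
Proof.
have C10 : 0 < C + 1 by rewrite addr_gt0 // (lt_trans _ C1).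
rewrite ltr_pdivlMr ?ltr_pwDl ?sqnorm_ge0 // ltr_pdivlMr //.
by rewrite -subr_gt0 -[RHS]subr_gt0; congr (0 < _); ring.
Qed.

Lemma capE : cap C = [set u | sqnorm u < k].
Proof. by apply/funext => u; apply/propext; rewrite /cap /= cosh_level_gt1. Qed.

Lemma sqnormZ (s : R) u : sqnorm (s *: u) = s ^+ 2 * sqnorm u.
Proof.
by rewrite /sqnorm mulr_sumr; apply: eq_bigr => i _; rewrite mxE exprMn.
Qed.

Lemma continuous_scale_vec u : continuous (fun s : R^o => s *: u).
Proof. by move=> s; exact: scalel_continuous. Qed.

(** The cap is star-shaped: it is a union of segments that all contain the origin. *)
Lemma connected_cap : connected (cap C).
Proof.
have -> : cap C = \bigcup_(u in cap C) ((fun s : R^o => s *: u) @` `[0, 1]).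
  rewrite eqEsubset; split=> [u Ou|_ [u Ou [s /= s01 <-]]].
    by exists u => //; exists 1; rewrite ?scale1r //= in_itv /= ler01 lexx.
  move: Ou; rewrite capE /= sqnormZ; apply: le_lt_trans.
  move: s01; rewrite in_itv /= => /andP[s0 s1].
  by rewrite ler_piMl ?sqnorm_ge0 // expr_le1.
apply: bigcup_connected => [|u _].
  by exists 0 => u _; exists 0; rewrite ?scale0r //= in_itv /= lexx ler01.
apply: connected_continuous_connected; first exact: segment_connected.
apply: continuous_subspaceT; exact: continuous_scale_vec.
Qed.

Lemma cap_sub_disc u : sqnorm u <= k -> @disc R u.
Proof.
move=> uk; rewrite /disc /=; apply: le_lt_trans uk _.
have C10 : 0 < C + 1 by rewrite addr_gt0 // (lt_trans _ C1).
by rewrite /k ltr_pdivrMr // mul1r ltrBlDr -addrA ltrDl.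
Qed.

Lemma closure_capE :
  closure (cap C) `&` @disc R = [set u | 1 <= cosh_level C u].
Proof.
rewrite eqEsubset; split=> [u [cu _]|u].
  have cl : closed [set u | 1 <= cosh_level C u].
    have -> : [set u | 1 <= cosh_level C u] =
        ~` [set u | 0 < 1 - cosh_level C u].
      apply/funext => v; apply/propext.
      by rewrite /= subr_gt0 leNgt; split=> /negP.
    apply: open_closedC; apply: open_elementary_gt0.
    exact: elementaryB (elementary_cst _ _) (elementary_cosh_level _ _).
  have sub : cap C `<=` [set u | 1 <= cosh_level C u] by move=> v; exact: ltW.
  by have := closure_subset sub cu; rewrite -(closure_id _).1.
rewrite /= cosh_level_ge1 => uk; split; last exact: cap_sub_disc.
move=> B nB.
(* A point of the closed cap is approached radially, by s u with s increasing to 1. *)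
have cB : (fun s : R^o => s *: u) @ (1 : R^o)^'- --> u.
  rewrite -[X in _ --> X]scale1r; apply: cvg_at_left_filter.
  exact: continuous_scale_vec.
have : \forall s \near (1 : R)^'-, (0 < s /\ s < 1) /\ B (s *: u).
  near=> s; split; last by near: s; exact: cB.
  by split; near: s; [exact: nbhs_left_gt|exact: nbhs_left_lt].
move=> /filter_ex[s [[s0 s1] Bs]]; exists (s *: u); split=> //.
rewrite capE /= sqnormZ.
(* Scaling strictly decreases the norm unless u = 0, and the origin lies in the open cap since k >
   0. *)
have := sqnorm_ge0 u; rewrite le_eqVlt => /orP[/eqP <-|u0].
  by rewrite mulr0 cap_radius_gt0.
by apply: lt_le_trans uk; rewrite gtr_pMl // expr_lt1 // ltW.
Unshelve. all: by end_near. Qed.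

(** Includes the boundary of the cap, out of reach of [elementary]: the square root is still
    continuous where its argument vanishes. *)
Lemma continuous_cap_height u : 1 <= cosh_level C u ->
  {for u, continuous (cap_height C)}.
Proof.
move=> u1; have cy : {for u, continuous (cosh_level C)}.
  exact: elementary_continuous openT (elementary_cosh_level C _) I.
have cc (c : R) : {for u, continuous (fun _ : 'rV[R]_2 => c : R^o)}.
  exact: elementary_continuous openT (elementary_cst _ c) I.
apply: continuousM; last exact: cc.
apply: (@continuous_comp _ _ _ (fun v => cosh_level C v
  + Num.sqrt (cosh_level C v ^+ 2 - 1)) (@ln R)); last first.
  by apply: continuous_ln; exact: arcosh_arg_gt0.
apply: continuousD => //.
apply: (@continuous_comp _ _ _ (fun v => cosh_level C v ^+ 2 - 1)
  (@Num.sqrt R)); last exact: sqrt_continuous.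
apply: continuousB; last exact: cc.
exact: continuousM.
Qed.

Lemma bi_graph_geodesic_sphere : bi_graph (geodesic_sphere C).
Proof.
exists (cap C), (cap_height C); cbv zeta; rewrite closure_capE /=.
have hE u : 1 <= cosh_level C u -> cosh (2 * cap_height C u) = cosh_level C u.
  by move=> u1; rewrite /cap_height mulrC divfK // arcoshK.
have sphereE p :
    geodesic_sphere C p <-> cosh (2 * height p) = cosh_level C (base p).
  have Q0 : 0 < 1 + qn p by rewrite ltr_pwDl ?qn_ge0.
  rewrite (geodesic_sphereE C1) /cosh_level sqnorm_base -/(qn p) heightE -/(ch p).
  split=> [<-|->]; first by rewrite mulrC mulKf ?gt_eqF.
  by rewrite mulrC divfK ?gt_eqF.
split.
- split.
  + exists 0; rewrite capE /= /sqnorm big1 ?cap_radius_gt0 // => i _.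
    by rewrite mxE expr0n.
  + exact: open_cap.
  + exact: connected_cap.
  + by move=> u; rewrite capE => /ltW; exact: cap_sub_disc.
- split.
    by apply: for_within_continuous => u; exact: continuous_cap_height.
  by apply: elementary_smooth; [exact: open_cap|exact: elementary_cap_height].
- by move=> u Ou; rewrite divr_gt0 // arcosh_gt0.
- move=> u u1 /negP; rewrite -leNgt => u1'.
  rewrite /cap_height (_ : cosh_level C u = 1) ?arcosh1 ?mul0r //.
  by apply: le_anti; rewrite u1 u1'.
- rewrite eqEsubset; split=> [p /sphereE pE|_ [[u u1 <-]|[u u1 <-]]]; last 2 first.
  + by apply/sphereE; rewrite base_point height_point hE.
  + by apply/sphereE; rewrite base_point height_point mulrN coshN hE.
  have p1 : 1 <= cosh_level C (base p) by rewrite -pE cosh_ge1.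
  have capH (t : R) : 0 <= t -> cosh (2 * t) = cosh_level C (base p) ->
      cap_height C (base p) = t.
    move=> t0 tE; rewrite /cap_height -tE coshK ?mulr_ge0 //.
    by apply: (mulIf (x := 2)) => //; rewrite divfK // mulrC.
  (* Since cosh is even, its value fixes the height up to sign; the sign decides between the upper
     and the lower graph. *)
  have [t0|t0] := leP 0 (height p); [left|right]; exists (base p) => //.
    by rewrite (capH (height p)) // point_base_height.
  rewrite (capH (- height p)) ?opprK ?point_base_height //.
    by rewrite oppr_ge0 ltW.
  by rewrite mulrN coshN.
Qed.

End BiGraph.

Unset Implicit Arguments.
Set Strict Implicit.

Theorem corollary4p6 (R : realType) (H : R) (hH : 1 < H) :
  let f := fun r : R => ln (2 * cosh r) in
  exists S : set 'rV[R]_(2 + 1),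
    [/\ S `<=` @ambient R /\ embedded_surface S,
        homeomorphic (@unit_sphere2 R) S,
        constant_mean_curvature (warped_metric f) S H,
        rotation_invariant S
      & exists c : R, bi_graph (vertical_translate c S)].
Proof.
move=> f; have d0 : 0 < H ^+ 2 - 1.
  by rewrite subr_gt0 expr_gt1 // ltW // (lt_trans _ hH).
have s0 : 0 < Num.sqrt (H ^+ 2 - 1) by rewrite sqrtr_gt0.
(* The radius d is determined by coth d = H: then r = sinh d = 1 / sqrt (H^2 - 1) and cosh d = H
   r. *)
pose r := (Num.sqrt (H ^+ 2 - 1))^-1.
have r0 : 0 < r by rewrite invr_gt0.
have Cr : (H * r) ^+ 2 = 1 + r ^+ 2.
  have r2 : r ^+ 2 * (H ^+ 2 - 1) = 1.
    by rewrite /r exprVn sqr_sqrtr ?ltW // mulVf // gt_eqF.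
  by rewrite -r2; ring.
have C1 : 1 < H * r.
  have Hr0 : 0 <= H * r by rewrite mulr_ge0 ?(ltW r0) // ltW // (lt_trans _ hH).
  by rewrite -(@ltr_pXn2r _ 2) ?nnegrE // Cr expr1n ltrDl exprn_gt0.
exists (geodesic_sphere (H * r)); split.
- by split=> [p []//|]; exact: embedded_geodesic_sphere.
- exact: homeomorphic_sphere C1 r0 Cr.
- by have := geodesic_sphere_cmc r0 Cr; rewrite mulrCA mulVf ?gt_eqF // mulr1.
- exact: rotation_invariant_geodesic_sphere.
(* The sphere is centred at height 0, so it is already symmetric about the slice. *)
- by exists 0; rewrite vertical_translate0; exact: bi_graph_geodesic_sphere.
Qed.
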